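(* Let $T=\sum_{\lambda\in\Lambda}c_\lambda U_\lambda$ with $\Lambda\subset\mathbb{R}^{2d}$ finite, $|\Lambda|=N$, and let $R_0=\max_{\lambda\in\Lambda}\|\lambda\|$. Assume $T$ is invertible in $B(L^2(\mathbb{R}^d))$. Put $A=\|T^{-1}\|_{B(L^2(\mathbb{R}^d))}^{-2}$, $B=\|T\|^2_{B(L^2(\mathbb{R}^d))}$ and $\rho=\max(1,2R_0)$. Let $v$ be a submultiplicative weight on $\mathbb{R}^{2d}$ whose radial function is polynomial: $w(r)=C(1+r)^m$ for all $r\ge0$, for some $C>0$ and $m\in\mathbb{N}$. Then $T^{-1}\in\mathcal{A}_v$ and $$\|T^{-1}\|_{\mathcal{A}_v}\le\frac{C\rho^m\|T\|_{\mathcal{A}_v}}{A}\,(m+N)!\left(\frac{A+B}{2A}\right)^{m+N}.$$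
   Context: For $\lambda=(t,\omega)\in\mathbb{R}^d\times\mathbb{R}^d$, $U_{(t,\omega)}f(x)=e^{i\langle\omega,x\rangle}f(x-t)$ on $L^2(\mathbb{R}^d)$; $\|\cdot\|$ is the Euclidean norm on $\mathbb{R}^{2d}$. A weight is a function $v:\mathbb{R}^{2d}\to[0,\infty)$ with $v(0)=1$, $v(-x)=v(x)$, radially non-decreasing; it is submultiplicative if $v(x+y)\le v(x)v(y)$; its radial function is $w(r)=\max_{\|x\|=r}v(x)$. $\mathcal{A}_v$ is the Banach algebra of operators $T=\sum_{\lambda\in\mathbb{R}^{2d}}c_\lambda U_\lambda$ with $\|T\|_{\mathcal{A}_v}:=\sum_\lambda v(\lambda)|c_\lambda|<\infty$. *)

(* Defs.v *)
From HB Require Import structures.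
From mathcomp Require Import all_boot all_order all_algebra.
From mathcomp Require Import all_classical all_reals all_analysis.
From mathcomp Require Import complex.
Set Implicit Arguments. Unset Strict Implicit. Unset Printing Implicit Defensive.
Import Order.TTheory GRing.Theory Num.Theory.
Import numFieldTopology.Exports numFieldNormedType.Exports.
Local Open Scope classical_set_scope.
Local Open Scope ring_scope.

(* Points of R^d are d-tuples of reals (the product = Borel sigma-algebra). *)
Definition Rd (R : realType) (d : nat) := d.-tuple R.
(* Points of the time-frequency plane R^{2d}: lambda = (t, omega). *)
Definition Rdd (R : realType) (d : nat) := (d.-tuple R * d.-tuple R)%type.

Section defs.
Variables (R : realType) (d : nat).
Local Notation C := R[i].

Definition cabs (z : C) : R := Num.sqrt (complex.Re z ^+ 2 + complex.Im z ^+ 2).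
Definition expi (th : R) : C := Complex (cos th) (sin th).

Definition tsub (x y : d.-tuple R) : d.-tuple R := [tuple tnth x i - tnth y i | i < d].
Definition tadd (x y : d.-tuple R) : d.-tuple R := [tuple tnth x i + tnth y i | i < d].
Definition tscale (s : R) (x : d.-tuple R) : d.-tuple R := [tuple s * tnth x i | i < d].
Definition tneg (x : d.-tuple R) : d.-tuple R := [tuple - tnth x i | i < d].
Definition tdot (x y : d.-tuple R) : R := \sum_(i < d) tnth x i * tnth y i.

Definition zero2 : Rdd R d := ([tuple 0 | i < d], [tuple 0 | i < d]).
Definition add2 (a b : Rdd R d) : Rdd R d := (tadd a.1 b.1, tadd a.2 b.2).
Definition neg2 (a : Rdd R d) : Rdd R d := (tneg a.1, tneg a.2).
Definition scale2 (s : R) (a : Rdd R d) : Rdd R d := (tscale s a.1, tscale s a.2).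
Definition norm2 (a : Rdd R d) : R := Num.sqrt (tdot a.1 a.1 + tdot a.2 a.2).

Definition U (lam : Rdd R d) (f : Rd R d -> C) : Rd R d -> C :=
  fun x => expi (tdot lam.2 x) * f (tsub x lam.1).

End defs.

(* d-dimensional Lebesgue integral of a nonnegative function, computed as the
   iterated one-dimensional Lebesgue integral (Tonelli; only applied to
   Borel-measurable nonnegative integrands below). *)
Fixpoint itint (R : realType) (n : nat) : (n.-tuple R -> \bar R) -> \bar R :=
  match n return (n.-tuple R -> \bar R) -> \bar R with
  | 0 => fun F => F [tuple]
  | n'.+1 => fun F =>
      (\int[@lebesgue_measure R]_x itint (fun t : n'.-tuple R => F (cons_tuple x t)))%E
  end.

Section L2.
Variables (R : realType) (d : nat).
Local Notation C := R[i].
Local Notation Fun := (Rd R d -> C).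

(* f is (a representative of an element) of L^2(R^d) *)
Definition L2 (f : Fun) : Prop :=
  measurable_fun [set: d.-tuple R] (fun x => complex.Re (f x)) /\
  measurable_fun [set: d.-tuple R] (fun x => complex.Im (f x)) /\
  (itint (fun x : d.-tuple R => ((cabs (f x)) ^+ 2)%:E) < +oo)%E.

Definition nrm2 (f : Fun) : R :=
  Num.sqrt (fine (itint (fun x : d.-tuple R => ((cabs (f x)) ^+ 2)%:E))).

Definition fsub (f g : Fun) : Fun := fun x => f x - g x.

(* S is (a representative of) a bounded linear operator on L^2(R^d) *)
Definition bounded_op (S : Fun -> Fun) : Prop :=
  (forall f, L2 f -> L2 (S f)) /\
  (forall (a : C) f g, L2 f -> L2 g ->
     nrm2 (fsub (S (fun x => a * f x + g x)) (fun x => a * S f x + S g x)) = 0) /\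
  (exists K : R, forall f, L2 f -> nrm2 (S f) <= K * nrm2 f).

Definition opnorm (S : Fun -> Fun) : R :=
  sup [set r | exists f, L2 f /\ nrm2 f <= 1 /\ r = nrm2 (S f)].

Definition is_inverse (T S : Fun -> Fun) : Prop :=
  bounded_op S /\
  (forall f, L2 f -> nrm2 (fsub (S (T f)) f) = 0) /\
  (forall f, L2 f -> nrm2 (fsub (T (S f)) f) = 0).

Definition finop (N : nat) (lam : 'I_N -> Rdd R d) (c : 'I_N -> C) : Fun -> Fun :=
  fun f x => \sum_(i < N) c i * U (lam i) f x.

Definition partial_op (mu : nat -> Rdd R d) (b : nat -> C) (k : nat) : Fun -> Fun :=
  fun f x => \sum_(n < k) b n * U (mu n) f x.

(* S belongs to A_v with ||S||_{A_v} <= K : S = sum_lambda c_lambda U_lambda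
   with (countably supported) coefficients enumerated injectively by
   (mu n, b n), sum_lambda v(lambda)|c_lambda| <= K, the series converging
   in B(L^2) (strongly, i.e. on every f in L^2). *)
Definition in_Av_le (v : Rdd R d -> R) (S : Fun -> Fun) (K : R) : Prop :=
  exists (mu : nat -> Rdd R d) (b : nat -> C),
    injective mu /\
    (\sum_(0 <= n <oo) ((v (mu n) * cabs (b n))%:E) <= K%:E)%E /\
    (forall f, L2 f ->
       (fun k => nrm2 (fsub (S f) (partial_op mu b k f))) @ \oo --> (0 : R)).

Definition weight (v : Rdd R d -> R) : Prop :=
  (forall x, 0 <= v x) /\ v (zero2 R d) = 1 /\ (forall x, v (neg2 x) = v x) /\
  (forall x (s t : R), 0 <= s -> s <= t -> v (scale2 s x) <= v (scale2 t x)).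

Definition submultiplicative (v : Rdd R d -> R) : Prop :=
  forall x y, v (add2 x y) <= v x * v y.

Definition radial_max_is (v : Rdd R d -> R) (r wr : R) : Prop :=
  (forall x, norm2 x = r -> v x <= wr) /\ (exists x, norm2 x = r /\ v x = wr).

End L2.

(* Main.v *)
Require Import Defs.
From HB Require Import structures.
From mathcomp Require Import all_boot all_order all_algebra.
From mathcomp Require Import all_classical all_reals all_analysis.
From mathcomp Require Import measurable_realfun complex.
From mathcomp Require Import ring lra.
Set Implicit Arguments. Unset Strict Implicit. Unset Printing Implicit Defensive.
Import Order.TTheory GRing.Theory Num.Theory.
Import numFieldTopology.Exports numFieldNormedType.Exports.
Local Open Scope classical_set_scope.
Local Open Scope ring_scope.

(* The inverse is the Neumann series [S = gam \sum_n W^n T^*], where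
   [gam = 2 / (A + B)] and [W = I - gam T^* T] has norm at most
   [q = (B - A) / (A + B)].  The coefficients of [W^n] have l^2-norm at most
   [q^n], because averaging over conjugations by time-frequency shifts shows that
   the l^2-norm of the coefficients never exceeds the operator norm.  The points of
   [W^n] are differences of two n-fold sums over [Lambda]: there are at most
   ['C(n + N - 1, N - 1) ^ 2] of them, all of norm at most [2 n R_0].  By
   Cauchy-Schwarz the weighted l^1-norm of [W^n] is therefore at most
   [Cw (1 + 2 n R_0)^m 'C(n + N - 1, N - 1) q^n], and summing over [n] gives the
   bound, since [1 - q = 2 A / (A + B)]. *)

(** * Lebesgue measure on tuples *)

Section Measure.
Variable R : realType.
Local Notation RB := (measurableTypeR R).

(** The weighted l^1-norm of [W] itself may exceed 1, so submultiplicativity alone cannot control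
    its powers. Only the l^2-norm of the merged coefficients inherits the decay [q ^+ n], and the
    polynomial growth of the number of points pays for the return to l^1. The factorial arises when
    [(1 + n) ^+ m] is absorbed into ['C(n + N - 1, N - 1)], giving ['C(n + m + N - 1, m + N - 1)],
    whose generating function is [(1 - q) ^- (m + N)]. Two features of the setting shape the rest.
    The integral is an iterated one, so a sigma-finite measure representing it is built first.
    Functions are not identified modulo null sets, so [S] is linear and inverse to [T] only up to
    functions of norm zero, whereas finite sums of shifts compose by pointwise identities. *)

Lemma measurable_cons_tuple (n : nat) :
  measurable_fun [set: RB * n.-tuple R]
    (fun p => cons_tuple p.1 p.2 : n.+1.-tuple R).
Proof.
exact: (@measurable_cons _ _ (RB * n.-tuple R)%type R fst n snd
  measurable_fst measurable_snd).
Qed.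

Lemma measurable_cons_tuplel (n : nat) (x : R) :
  measurable_fun [set: n.-tuple R] (cons_tuple x : n.-tuple R -> n.+1.-tuple R).
Proof. by apply: (@measurable_cons _ _ (n.-tuple R) R (cst x) n id). Qed.

(** Tonelli, by induction: the measure in dimension [n.+1] is the pushforward under [cons_tuple] of
    a product with Lebesgue measure. Sigma-finiteness is part of the statement because the next
    product needs it. *)
Lemma itint_measure (n : nat) :
  exists mu : {sigma_finite_measure set (n.-tuple R) -> \bar R},
    forall F : n.-tuple R -> \bar R, measurable_fun [set: n.-tuple R] F ->
      (forall x, 0 <= F x)%E -> itint F = (\int[mu]_x F x)%E.
Proof.
elim: n => [|n [mu IH]].
  exists (dirac ([tuple] : 0.-tuple R)) => F mF F0.
  by rewrite integral_dirac//= diracE in_setT mul1e.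
pose cons2 (p : RB * n.-tuple R) : n.+1.-tuple R := cons_tuple p.1 p.2.
have mcons : measurable_fun setT cons2 by exact: measurable_cons_tuple.
pose pi : {measure set _ -> \bar R} := (@lebesgue_measure R \x mu)%E.
pose nuf : {measure set (n.+1.-tuple R) -> \bar R} := pushforward pi cons2.
pose nu0 := nuf mcons.
pose uncons (t : n.+1.-tuple R) : RB * n.-tuple R := (thead t, [tuple of behead t]).
have consK : cancel cons2 uncons.
  by move=> [x t]; rewrite /uncons /cons2 /= theadE; congr pair; apply: val_inj.
have muncons : measurable_fun [set: n.+1.-tuple R] uncons.
  have m1 : measurable_fun [set: n.+1.-tuple R] (fun t => thead t : R).
    exact: (@measurable_tnth _ R _ ord0).
  have m2 := @measurable_behead _ R n.
  exact: (measurable_fun_pair (m1 : measurable_fun _ (_ : _ -> RB)) m2).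
have snu : sigma_finite setT nu0.
  have /sigma_finiteP[F [TF ndF Foo]] := sigma_finiteT (@lebesgue_measure R).
  have /sigma_finiteP[G [TG ndG Goo]] := sigma_finiteT mu.
  exists (fun k => uncons @^-1` (F k `*` G k)).
    rewrite -preimage_bigcup (_ : \bigcup_i _ = setT) ?preimage_setT//.
    apply/seteqP; split=> // -[x y] _.
    have [k _ Fx] : (\bigcup_i F i) x by rewrite -TF.
    have [l _ Gy] : (\bigcup_i G i) y by rewrite -TG.
    (* Both exhaustions increase, so the diagonal rectangles [F k] times [G k] already cover the
       product. *)
    exists (maxn k l) => //; split => /=.
      by move: x Fx; exact/subsetPset/ndF/leq_maxl.
    by move: y Gy; exact/subsetPset/ndG/leq_maxr.
  move=> k; have [mF ?] := Foo k; have [mG ?] := Goo k.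
  have mFG : measurable (F k `*` G k) by exact: measurableX.
  split; first by rewrite -[X in measurable X]setTI; exact: muncons.
  rewrite /nu0 /nuf /= /pushforward -comp_preimage.
  rewrite (_ : uncons \o cons2 = id); last exact/funext.
  rewrite preimage_id.
  rewrite product_measure1E//; apply: lte_mul_pinfty => //; by rewrite ge0_fin_numE.
pose nu : {sigma_finite_measure set (n.+1.-tuple R) -> \bar R} :=
  HB.pack (Measure.sort nu0) (Measure_isSigmaFinite.Build _ _ _ (Measure.sort nu0) snu).
exists nu => F mF F0 /=.
transitivity (\int[nu0]_x F x)%E => //.
rewrite ge0_integral_pushforward// preimage_setT.
have mFc : measurable_fun [set: RB * n.-tuple R] (F \o cons2).
  by apply: (measurableT_comp mF); exact: mcons.
transitivity (\int[@lebesgue_measure R]_x fubini_F mu (F \o cons2) x)%E; last first.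
  by apply/esym; apply: fubini_tonelli1 => // x; exact: F0.
apply: eq_integral => x _; rewrite /fubini_F IH//.
exact: measurableT_comp mF (measurable_cons_tuplel x).
Qed.

End Measure.

(** * Translation invariance and the unit cube *)

Section Translation.
Variable R : realType.
Local Notation RB := (measurableTypeR R).

(** The pushforward of Lebesgue measure under the shift agrees with it on half-open intervals, hence
    everywhere by uniqueness; the rest is a change of variables. *)
Lemma lebesgue_integral_translate (a : R) (F : RB -> \bar R) :
  measurable_fun setT F -> (forall x, 0 <= F x)%E ->
  (\int[@lebesgue_measure R]_x F (x - a)%R = \int[@lebesgue_measure R]_x F x)%E.
Proof.
move=> mF F0.
pose sh (x : RB) : RB := x - a.
have msh : measurable_fun setT sh.
  have := @measurable_funB _ RB R setT idfun (cst a) (@measurable_id _ _ _) (measurable_cst _).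
  by [].
pose nuf : {measure set RB -> \bar R} := pushforward (@lebesgue_measure R) sh.
pose nu := nuf msh.
have E : forall A, measurable A -> lebesgue_measure A = nu A.
  apply: lebesgue_measure_unique => X [[b c] /= bc <-].
  rewrite /nu /nuf /= /pushforward.
  rewrite (_ : sh @^-1` _ = `](b + a), (c + a)]%classic).
    rewrite !lebesgue_measure_itv/= !lte_fin ltrD2r.
    by case: ifP => // _; rewrite -!EFinD; congr EFin; ring.
  by apply/seteqP; split=> x /=; rewrite !in_itv /= /sh ltrBrDr lerBlDr.
rewrite [RHS](eq_measure_integral nu); last by move=> A mA _; exact: E.
by rewrite ge0_integral_pushforward// preimage_setT.
Qed.

Lemma measurable_fun_tsub (n : nat) (a : n.-tuple R) :
  measurable_fun [set: n.-tuple R] (fun x => tsub x a).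
Proof.
apply/measurable_fun_tnthP => i.
rewrite (_ : _ \o _ = fun x => tnth x i - tnth a i).
  by apply: measurable_funB => //; exact: measurable_tnth.
by apply/funext => x /=; rewrite tnth_mktuple.
Qed.

Lemma tsub_cons (n : nat) (x : R) (t : n.-tuple R) (a : n.+1.-tuple R) :
  tsub (cons_tuple x t) a = cons_tuple (x - thead a) (tsub t [tuple of behead a]).
Proof.
apply: eq_from_tnth => i; rewrite tnth_mktuple.
have [j ->|->] := unliftP ord0 i; last by rewrite !tnth0.
rewrite !tnthS tnth_mktuple; congr (_ - _); rewrite [in LHS](tuple_eta a) tnthS.
by congr tnth; exact: val_inj.
Qed.

Lemma itint_translate (n : nat) (a : n.-tuple R) (F : n.-tuple R -> \bar R) :
  measurable_fun [set: n.-tuple R] F -> (forall x, 0 <= F x)%E ->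
  itint (fun x => F (tsub x a)) = itint F.
Proof.
elim: n a F => [|n IH] a F mF F0; first by rewrite /= !(tuple0 (tsub _ _)).
rewrite /=.
have mcons (x : R) : measurable_fun [set: n.-tuple R] (fun t => F (cons_tuple x t)).
  exact: measurableT_comp mF (measurable_cons_tuplel x).
have [mu muE] := itint_measure R n.
pose H (x : RB) := itint (fun t : n.-tuple R => F (cons_tuple x t)).
have HE : H = fubini_F mu (fun p : RB * n.-tuple R => F (cons_tuple p.1 p.2)).
  by apply/funext => x; rewrite /H muE.
have mH : measurable_fun setT H.
  rewrite HE; apply: measurable_fun_fubini_tonelli_F => //.
  exact: measurableT_comp mF (@measurable_cons_tuple R n).
transitivity (\int[@lebesgue_measure R]_x H (x - thead a)%R)%E; last first.
  rewrite lebesgue_integral_translate// => x; rewrite HE.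
  by apply: integral_ge0 => y _.
apply: eq_integral => x _; rewrite /H -(IH [tuple of behead a] (fun t => F (cons_tuple
  (x - thead a) t)))//.
by congr itint; apply/funext => t; congr F; exact: tsub_cons.
Qed.

(** Source of the unit vector of [exists_L2_unit]; [all] unfolds along [cons_tuple], as the iterated
    integral does. *)
Definition cube (n : nat) (t : n.-tuple R) : R := (all (fun x => 0 <= x <= 1) t)%:R.

Lemma itint_cube (n : nat) : itint (fun t : n.-tuple R => (cube t)%:E) = 1%E.
Proof.
elim: n => [//|n IH] /=.
transitivity (\int[@lebesgue_measure R]_x (\1_`[0%R, 1%R] x)%:E)%E; last first.
  rewrite integral_indic//.
  rewrite setIT; apply: etrans (lebesgue_measure_itv `[0%R, 1%R]) _.
  by rewrite /= lte_fin ltr01 -EFinB subr0.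
apply: eq_integral => x _.
have -> : (\1_`[0%R, 1%R] x : R) = (0 <= x <= 1)%R%:R.
  by rewrite indicE mem_setE in_itv.
have [x01|x01] := boolP (0 <= x <= 1)%R.
  by rewrite -[RHS]IH; congr itint; apply/funext => t; rewrite /cube/= x01.
have [mu muE] := itint_measure R n.
rewrite (_ : (fun t => _) = cst 0%E); last first.
  by apply/funext => t; rewrite /cube/= (negbTE x01).
by rewrite muE// integral0.
Qed.

Lemma measurable_cube (n : nat) : measurable_fun [set: n.-tuple R] (@cube n).
Proof.
rewrite (_ : @cube n = fun t => \prod_(i < n) \1_`[0%R, 1%R] (tnth t i)).
  apply: measurable_prod => i _.
  apply: (measurableT_comp (f := \1_`[0%R, 1%R] : R -> R)); last exact: measurable_tnth.
  exact: measurable_indic.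
apply/funext => t; rewrite /cube; have [/allP tP|/allPn[x /tnthP[i ->] xN]] := boolP (all _ _).
  rewrite big1// => i _; rewrite indicE mem_setE in_itv /= tP//; exact: mem_tnth.
by rewrite (bigD1 i)//= indicE mem_setE in_itv /= (negbTE xN) mul0r.
Qed.
End Translation.

(** * The space of square-integrable functions *)

Section L2theory.
Variables (R : realType) (d : nat).
Local Notation C := R[i].
Local Notation Fun := (Rd R d -> C).
Implicit Types (f g h : Fun) (lam : Rdd R d) (z w a : C).

Definition tuple_lebesgue : {sigma_finite_measure set (d.-tuple R) -> \bar R} :=
  sval (cid (itint_measure R d)).

Lemma itint_tuple_lebesgue (F : d.-tuple R -> \bar R) : measurable_fun [set: d.-tuple R] F ->
  (forall x, 0 <= F x)%E -> itint F = (\int[tuple_lebesgue]_x F x)%E.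
Proof. exact: (svalP (cid (itint_measure R d))). Qed.

(** The real part of [z] times the conjugate of [w]. Working with a real inner product keeps all
    integrals real; the complex one is recovered in [hermitian_ip]. *)
Definition dotc (z w : C) : R := complex.Re z * complex.Re w + complex.Im z * complex.Im w.

Lemma cabs_sqr z : cabs z ^+ 2 = dotc z z.
Proof. by rewrite /cabs sqr_sqrtr ?addr_ge0 ?sqr_ge0// /dotc !expr2. Qed.

Lemma cabs_ge0 (z : C) : 0 <= cabs z. Proof. exact: sqrtr_ge0. Qed.

Lemma dotc_ge0 z : 0 <= dotc z z.
Proof. by rewrite -cabs_sqr sqr_ge0. Qed.

Lemma dotcC z w : dotc z w = dotc w z.
Proof. by rewrite /dotc mulrC [X in _ + X]mulrC. Qed.

Lemma dotcDl z1 z2 w : dotc (z1 + z2) w = dotc z1 w + dotc z2 w.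
Proof. by case: z1 z2 w => [a b] [c e] [g h]; rewrite /dotc /=; ring. Qed.

Lemma dotcM a z w : dotc (a * z) w = dotc z (a^*%C * w).
Proof. by case: a z w => [a b] [c e] [g h]; rewrite /dotc /=; ring. Qed.

Lemma dotcMM a z : dotc (a * z) (a * z) = dotc a a * dotc z z.
Proof. by case: a z => [a b] [c e]; rewrite /dotc /=; ring. Qed.

Lemma dotcZ (r : R) z w : dotc (r%:C%C * z) w = r * dotc z w.
Proof. by case: z w => [c e] [g h]; rewrite /dotc /=; ring. Qed.

Lemma measurable_dotc (f g : Fun) :
  measurable_fun [set: d.-tuple R] (fun x => complex.Re (f x)) ->
  measurable_fun [set: d.-tuple R] (fun x => complex.Im (f x)) ->
  measurable_fun [set: d.-tuple R] (fun x => complex.Re (g x)) ->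
  measurable_fun [set: d.-tuple R] (fun x => complex.Im (g x)) ->
  measurable_fun [set: d.-tuple R] (fun x => dotc (f x) (g x)).
Proof. by move=> *; apply: measurable_funD; apply: measurable_funM. Qed.

Definition sqint (f : Fun) := tuple_lebesgue.-integrable setT (fun x => (dotc (f x) (f x))%:E).

Lemma itint_cabs (f : Fun) :
  measurable_fun [set: d.-tuple R] (fun x => complex.Re (f x)) ->
  measurable_fun [set: d.-tuple R] (fun x => complex.Im (f x)) ->
  itint (fun x : d.-tuple R => ((cabs (f x)) ^+ 2)%:E)
    = (\int[tuple_lebesgue]_x (dotc (f x) (f x))%:E)%E.
Proof.
move=> mr mi; rewrite itint_tuple_lebesgue.
- by apply: eq_integral => x _; rewrite cabs_sqr.
- rewrite (_ : (fun x => _) = EFin \o (fun x => dotc (f x) (f x))).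
    by apply/measurable_EFinP; exact: measurable_dotc.
  by apply/funext => x /=; rewrite cabs_sqr.
- by move=> x; rewrite lee_fin sqr_ge0.
Qed.

Lemma L2P (f : Fun) : L2 f <->
  [/\ measurable_fun [set: d.-tuple R] (fun x => complex.Re (f x)),
      measurable_fun [set: d.-tuple R] (fun x => complex.Im (f x)) & sqint f].
Proof.
split=> [[mr [mi fi]]|[mr mi fi]].
  split=> //; apply/integrableP; split.
    by apply/measurable_EFinP; exact: measurable_dotc.
  move: fi; rewrite itint_cabs//; congr (_ < _)%E.
  by apply: eq_integral => x _; rewrite gee0_abs// lee_fin dotc_ge0.
split=> //; split=> //; rewrite itint_cabs//.
have /integrableP[_] := fi; congr (_ < _)%E.
by apply: eq_integral => x _; rewrite gee0_abs// lee_fin dotc_ge0.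
Qed.

Lemma dotc_le (z w : C) : `|dotc z w| <= dotc z z + dotc w w.
Proof.
case: z w => [a b] [c e]; rewrite /dotc /= ler_norml.
have := sqr_ge0 (a - c); have := sqr_ge0 (b - e).
have := sqr_ge0 (a + c); have := sqr_ge0 (b + e).
have := sqr_ge0 a; have := sqr_ge0 b; have := sqr_ge0 c; have := sqr_ge0 e.
by rewrite !expr2 => ????????; apply/andP; split; lra.
Qed.

Lemma integrable_dotc (f g : Fun) : L2 f -> L2 g ->
  tuple_lebesgue.-integrable setT (fun x => (dotc (f x) (g x))%:E).
Proof.
move=> /L2P[fr fi fI] /L2P[gr gi gI].
apply: (le_integrable _ _ _ (integrableD measurableT fI gI)) => //.
  by apply/measurable_EFinP; exact: measurable_dotc.
move=> x _; rewrite -EFinD /= lee_fin (le_trans (dotc_le _ _))//.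
by rewrite ler_norm.
Qed.

Definition ip (f g : Fun) : R := (\int[tuple_lebesgue]_x (dotc (f x) (g x)))%R.

Lemma ipC f g : ip f g = ip g f.
Proof. by apply: eq_Rintegral => x _; rewrite dotcC. Qed.

Lemma L2D f g : L2 f -> L2 g -> L2 (fun x => f x + g x).
Proof.
move=> Lf Lg; have /L2P[fr fi fI] := Lf; have /L2P[gr gi gI] := Lg.
have ReE : (fun x : d.-tuple R => complex.Re (f x + g x)) = (fun x => complex.Re (f x)
  + complex.Re (g x)).
  by apply/funext => x; case: (f x) (g x) => [? ?] [? ?].
have ImE : (fun x : d.-tuple R => complex.Im (f x + g x)) = (fun x => complex.Im (f x)
  + complex.Im (g x)).
  by apply/funext => x; case: (f x) (g x) => [? ?] [? ?].
apply/L2P; rewrite ReE ImE; split; [exact: measurable_funD..|].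
have fgI := integrable_dotc Lf Lg.
rewrite /sqint (_ : (fun x => _) =
  ((fun x => (dotc (f x) (f x))%:E + (dotc (f x) (g x))%:E) \+
  (fun x => (dotc (f x) (g x))%:E + (dotc (g x) (g x))%:E))%E).
  by apply: integrableD => //; apply: integrableD.
apply/funext => x /=; rewrite -!EFinD; congr EFin.
by rewrite dotcDl (dotcC (f x) (_ + _)) (dotcC (g x) (_ + _)) !dotcDl (dotcC (g x) (f x)).
Qed.

Lemma L2Z (a : C) f : L2 f -> L2 (fun x => a * f x).
Proof.
move=> /L2P[fr fi fI].
have ReE : (fun x : d.-tuple R => complex.Re (a * f x)) =
    (fun x => complex.Re a * complex.Re (f x) - complex.Im a * complex.Im (f x)).
  by apply/funext => x; case: a (f x) => [? ?] [? ?].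
have ImE : (fun x : d.-tuple R => complex.Im (a * f x)) =
    (fun x => complex.Re a * complex.Im (f x) + complex.Im a * complex.Re (f x)).
  by clear ReE; apply/funext => x; case: a (f x) => [? ?] [? ?].
apply/L2P; rewrite ReE ImE; split.
- by apply: measurable_funB; apply: measurable_funM.
- by apply: measurable_funD; apply: measurable_funM.
rewrite /sqint (_ : (fun x => _) = (fun x => (dotc a a)%:E * (dotc (f x) (f x))%:E)%E).
  exact: integrableZl.
by apply/funext => x; rewrite dotcMM.
Qed.

Lemma L20 : L2 (fun _ : Rd R d => 0).
Proof.
apply/L2P; split; [exact: measurable_cst..|].
rewrite /sqint (_ : (fun x => _) = cst 0%E); first exact: integrable0.
by apply/funext => x; rewrite /dotc /= !mul0r addr0.
Qed.

Lemma L2_sum (I : Type) (s : seq I) (F : I -> Fun) :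
  (forall i, L2 (F i)) -> L2 (fun x => \sum_(i <- s) F i x).
Proof.
move=> LF; elim: s => [|i s IH].
  by rewrite (_ : (fun x => _) = fun=> 0); [exact: L20|apply/funext => x; rewrite big_nil].
rewrite (_ : (fun x => _) = fun x => F i x + \sum_(j <- s) F j x); first exact: L2D.
by apply/funext => x; rewrite big_cons.
Qed.

Lemma L2B f g : L2 f -> L2 g -> L2 (fun x => f x - g x).
Proof.
move=> Lf Lg; rewrite (_ : (fun x => _) = fun x => f x + -1 * g x).
  by apply: L2D => //; exact: L2Z.
by apply/funext => x; rewrite mulN1r.
Qed.

Lemma ipDl f g h : L2 f -> L2 g -> L2 h ->
  ip (fun x => f x + g x) h = ip f h + ip g h.
Proof.
move=> Lf Lg Lh; rewrite /ip -RintegralD//; try exact: integrable_dotc.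
by apply: eq_Rintegral => x _; rewrite dotcDl.
Qed.

Lemma ipDr f g h : L2 f -> L2 g -> L2 h ->
  ip h (fun x => f x + g x) = ip h f + ip h g.
Proof. by move=> *; rewrite ipC ipDl// ipC [X in _ + X]ipC. Qed.

Lemma ipM a f g : ip (fun x => a * f x) g = ip f (fun x => a^*%C * g x).
Proof. by apply: eq_Rintegral => x _; rewrite dotcM. Qed.

Lemma ipZl (r : R) f g : L2 f -> L2 g -> ip (fun x => r%:C%C * f x) g = r * ip f g.
Proof.
move=> Lf Lg; rewrite /ip -RintegralZl//; last exact: integrable_dotc.
by apply: eq_Rintegral => x _; rewrite dotcZ.
Qed.

Lemma ipZr (r : R) f g : L2 f -> L2 g -> ip g (fun x => r%:C%C * f x) = r * ip g f.
Proof. by move=> *; rewrite ipC ipZl// ipC. Qed.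

Lemma ipMM a f : L2 f -> ip (fun x => a * f x) (fun x => a * f x) = cabs a ^+ 2 * ip f f.
Proof.
move=> Lf; rewrite /ip -RintegralZl//; last exact: integrable_dotc.
by apply: eq_Rintegral => x _; rewrite dotcMM cabs_sqr.
Qed.

Lemma ip_ge0 f : 0 <= ip f f.
Proof. by apply: Rintegral_ge0 => x _; exact: dotc_ge0. Qed.

Lemma nrm2_sqr f : L2 f -> nrm2 f ^+ 2 = ip f f.
Proof.
move=> /L2P[fr fi fI]; rewrite /nrm2 itint_cabs// sqr_sqrtr//; exact: ip_ge0.
Qed.

Lemma nrm2_ge0 f : 0 <= nrm2 f. Proof. exact: sqrtr_ge0. Qed.

Lemma cabsU lam f x : cabs (U lam f x) ^+ 2 = cabs (f (tsub x lam.1)) ^+ 2.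
Proof.
rewrite /U !cabs_sqr dotcMM [X in X * _](_ : _ = 1) ?mul1r//.
by rewrite /dotc /= -!expr2 cos2Dsin2.
Qed.

Lemma itintU lam f : L2 f ->
  itint (fun x : d.-tuple R => ((cabs (U lam f x)) ^+ 2)%:E)
  = itint (fun x : d.-tuple R => ((cabs (f x)) ^+ 2)%:E).
Proof.
move=> /L2P[fr fi fI].
rewrite -[RHS](itint_translate lam.1 (F := fun x => ((cabs (f x)) ^+ 2)%:E)).
- by congr itint; apply/funext => x; rewrite cabsU.
- rewrite (_ : (fun x => _) = EFin \o (fun x => dotc (f x) (f x))).
    by apply/measurable_EFinP; exact: measurable_dotc.
  by apply/funext => x /=; rewrite cabs_sqr.
- by move=> x; rewrite lee_fin sqr_ge0.
Qed.

Lemma measurable_tdot (w : d.-tuple R) : measurable_fun [set: d.-tuple R] (tdot w).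
Proof.
apply: measurable_sum => i; apply: measurable_funM => //.
exact: measurable_tnth.
Qed.

Lemma L2U lam f : L2 f -> L2 (U lam f).
Proof.
move=> Lf; have [mr [mi fin]] := Lf.
have mcos : measurable_fun [set: d.-tuple R] (fun x => cos (tdot lam.2 x)).
  apply: (measurableT_comp (f := @cos R)) (measurable_tdot _).
  by apply: continuous_measurable_fun; exact: continuous_cos.
have msin : measurable_fun [set: d.-tuple R] (fun x => sin (tdot lam.2 x)).
  apply: (measurableT_comp (f := @sin R)) (measurable_tdot _).
  by apply: continuous_measurable_fun; exact: continuous_sin.
have mrs := measurableT_comp mr (measurable_fun_tsub lam.1).
have mis := measurableT_comp mi (measurable_fun_tsub lam.1).
split; last split; last by rewrite itintU.
- rewrite (_ : (fun x => _) = fun x : d.-tuple R =>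
    cos (tdot lam.2 x) * complex.Re (f (tsub x lam.1)) - sin (tdot lam.2 x) * complex.Im
      (f (tsub x lam.1))).
    by apply: measurable_funB; apply: measurable_funM.
  by apply/funext => x; rewrite /U; case: (f _).
- rewrite (_ : (fun x => _) = fun x : d.-tuple R =>
    cos (tdot lam.2 x) * complex.Im (f (tsub x lam.1)) + sin (tdot lam.2 x) * complex.Re
      (f (tsub x lam.1))).
    by apply: measurable_funD; apply: measurable_funM.
  by apply/funext => x; rewrite /U; case: (f _).
Qed.

Lemma nrm2U lam f : L2 f -> nrm2 (U lam f) = nrm2 f.
Proof. by move=> Lf; rewrite /nrm2 itintU. Qed.

(** Polarization: the real inner product is determined by norms, which shifts preserve. *)
Lemma ipU lam f g : L2 f -> L2 g -> ip (U lam f) (U lam g) = ip f g.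
Proof.
move=> Lf Lg; have LD := L2D Lf Lg.
have pol h k : L2 h -> L2 k -> ip h k =
    (ip (fun x => h x + k x) (fun x => h x + k x) - ip h h - ip k k) / 2.
  by move=> Lh Lk; have LD' := L2D Lh Lk; rewrite ipDl// !ipDr// (ipC k h); field.
rewrite pol ?(pol f g)//; try exact: L2U.
rewrite (_ : (fun x => U lam f x + U lam g x) = U lam (fun x => f x + g x)); last first.
  by apply/funext => x; rewrite /U mulrDr.
by rewrite -!nrm2_sqr ?nrm2U//; exact: L2U.
Qed.


(** The discriminant criterion, shared by every Cauchy-Schwarz inequality below and by
    [selfadjoint_norm]. *)
Lemma quadratic_le (x y z : R) : (forall t : R, 0 <= x + 2 * t * y + t ^+ 2 * z) ->
  0 <= x -> 0 <= z -> y ^+ 2 <= x * z.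
Proof.
move=> H x0; rewrite le_eqVlt => /orP[/eqP z0|z0].
  have [->|y0] := eqVneq y 0; first by rewrite expr0n /= -z0 mulr0.
  (* For [z = 0] the polynomial is affine in [t], and takes the value -1 here unless [y = 0]. *)
  have := H (- (x + 1) / (2 * y)); rewrite -z0 mulr0 addr0.
  rewrite (_ : 2 * _ * y = - (x + 1)); last by field.
  by rewrite opprD addrA subrr add0r oppr_ge0 ler10.
have := H (- y / z).
rewrite (_ : _ + _ = (x * z - y ^+ 2) / z); last by field; rewrite gt_eqF.
by rewrite pmulr_lge0 ?invr_gt0// subr_ge0.
Qed.

Lemma ip_CS f g : L2 f -> L2 g -> ip f g ^+ 2 <= ip f f * ip g g.
Proof.
move=> Lf Lg; apply: quadratic_le; try exact: ip_ge0.
move=> t; have Lt := L2Z t%:C%C Lg.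
have := ip_ge0 (fun x => f x + t%:C%C * g x).
rewrite ipDl// ?ipDr//; try exact: L2D.
rewrite !ipZl// !ipZr// (ipC g f); congr (_ <= _); ring.
Qed.

Lemma nrm2E f : L2 f -> nrm2 f = Num.sqrt (ip f f).
Proof. by move=> Lf; rewrite -nrm2_sqr// sqrtr_sqr ger0_norm// nrm2_ge0. Qed.

Lemma nrm2D f g : L2 f -> L2 g -> nrm2 (fun x => f x + g x) <= nrm2 f + nrm2 g.
Proof.
move=> Lf Lg; have LD := L2D Lf Lg.
rewrite -(@ler_pXn2r _ 2) ?nnegrE ?addr_ge0 ?nrm2_ge0//.
rewrite nrm2_sqr// ipDl// !ipDr// sqrrD !nrm2_sqr// (ipC g f).
have : ip f g <= nrm2 f * nrm2 g.
  apply: le_trans (ler_norm _) _.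
  rewrite -(@ler_pXn2r _ 2) ?nnegrE ?mulr_ge0 ?nrm2_ge0//.
  by rewrite exprMn !nrm2_sqr// real_normK ?num_real// ip_CS.
by lra.
Qed.

Lemma nrm2Z a f : L2 f -> nrm2 (fun x => a * f x) = cabs a * nrm2 f.
Proof.
move=> Lf; rewrite nrm2E; last exact: L2Z.
by rewrite ipMM// sqrtrM ?sqr_ge0// sqrtr_sqr ger0_norm ?cabs_ge0// -nrm2E.
Qed.

Lemma nrm20 : nrm2 (fun _ : Rd R d => 0) = 0.
Proof.
rewrite (_ : (fun _ => _) = fun x : Rd R d => 0 * 0); last by apply/funext=> x; rewrite mul0r.
rewrite nrm2Z; last exact: L20.
by rewrite /cabs /= expr0n /= addr0 sqrtr0 mul0r.
Qed.

Lemma cabsr (r : R) : cabs r%:C%C = `|r|.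
Proof. by rewrite /cabs /= [0 ^+ 2]expr0n /= addr0 sqrtr_sqr. Qed.

Lemma cabsN1 : cabs (-1 : C) = 1.
Proof. by rewrite /cabs /= oppr0 expr0n /= addr0 sqrrN expr1n sqrtr1. Qed.

Lemma nrm2_fsubC f g : L2 f -> L2 g -> nrm2 (fsub f g) = nrm2 (fsub g f).
Proof.
move=> Lf Lg; rewrite (_ : fsub f g = fun x => -1 * fsub g f x); last first.
  by apply/funext => x; rewrite /fsub mulN1r opprB.
by rewrite nrm2Z ?cabsN1 ?mul1r//; exact: L2B.
Qed.

(** Stands in for rewriting with an equality in L^2, which is available only up to a null
    function. *)
Lemma nrm2_null f g : L2 f -> L2 g -> nrm2 (fsub f g) = 0 -> nrm2 f = nrm2 g.
Proof.
move=> Lf Lg fg0; have Lfg : L2 (fsub f g) := L2B Lf Lg.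
have Lgf : L2 (fsub g f) := L2B Lg Lf.
apply/eqP; rewrite eq_le; apply/andP; split.
  rewrite {1}(_ : f = fun x => fsub f g x + g x).
    by apply: le_trans (nrm2D _ _) _ => //; rewrite fg0 add0r.
  by apply/funext => x; rewrite /fsub subrK.
rewrite {1}(_ : g = fun x => fsub g f x + f x).
  by apply: le_trans (nrm2D _ _) _ => //; rewrite nrm2_fsubC// fg0 add0r.
by apply/funext => x; rewrite /fsub subrK.
Qed.

Lemma exists_L2_unit : exists2 f : Fun, L2 f & nrm2 f = 1.
Proof.
pose f : Fun := fun x => (cube x)%:C%C.
have cE x : cabs (f x) ^+ 2 = cube x.
  by rewrite /f cabsr real_normK ?num_real// /cube; case: all; rewrite ?expr1n ?expr0n.
have fE : itint (fun x : d.-tuple R => ((cabs (f x)) ^+ 2)%:E) = 1%E.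
  by rewrite -[RHS](itint_cube R d); congr itint; apply/funext => x; rewrite cE.
exists f.
  split; first exact: measurable_cube.
  by split; [exact: measurable_cst|rewrite fE ltry].
by rewrite /nrm2 fE /= sqrtr1.
Qed.

End L2theory.

(** * Finite sums of time-frequency shifts *)

Lemma big_eq_seq (V : nmodType) (I : eqType) (r : seq I) (i : I) (F : I -> V) :
  uniq r -> \sum_(j <- r | i == j) F j = if i \in r then F i else 0.
Proof.
move=> ur; case: ifP => [ir|ir].
  rewrite big_mkcond (bigD1_seq i)//= eqxx big1_seq ?addr0// => j /andP[ji _].
  by rewrite eq_sym (negbTE ji).
by rewrite big1_seq// => j /andP[/eqP <-]; rewrite ir.
Qed.

Section FormalSums.
Variables (R : realType) (d : nat).
Local Notation C := R[i].
Local Notation Fun := (Rd R d -> C).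
Local Notation L := (Rdd R d).
Local Notation terms := (seq (C * Rdd R d)).
Implicit Types (f g h : Fun) (lam mu nu : L) (z w a : C) (s t : terms).

Lemma add2C : commutative (@add2 R d).
Proof.
by move=> x y; congr pair; apply: eq_from_tnth => i; rewrite !tnth_mktuple addrC.
Qed.

Lemma tsubD (x a b : Rd R d) : tsub x (tadd a b) = tsub (tsub x a) b.
Proof. by apply: eq_from_tnth => i; rewrite !tnth_mktuple opprD addrA. Qed.

Lemma tsub0 (x : Rd R d) : tsub x [tuple 0 | i < d] = x.
Proof. by apply: eq_from_tnth => i; rewrite !tnth_mktuple subr0. Qed.

Lemma taddNr (x : Rd R d) : tadd x (tneg x) = [tuple 0 | i < d].
Proof. by apply: eq_from_tnth => i; rewrite !tnth_mktuple subrr. Qed.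

Lemma tdotC (a b : Rd R d) : tdot a b = tdot b a.
Proof. by apply: eq_bigr => i _; rewrite mulrC. Qed.

Lemma tdotDl (a b x : Rd R d) : tdot (tadd a b) x = tdot a x + tdot b x.
Proof. by rewrite -big_split; apply: eq_bigr => i _; rewrite tnth_mktuple mulrDl. Qed.

Lemma tdotBr (a x y : Rd R d) : tdot a (tsub x y) = tdot a x - tdot a y.
Proof. by rewrite -sumrB; apply: eq_bigr => i _; rewrite tnth_mktuple mulrBr. Qed.

Lemma tdotBl (a x y : Rd R d) : tdot (tsub x y) a = tdot x a - tdot y a.
Proof. by rewrite tdotC tdotBr !(tdotC a). Qed.

Lemma tdotNl (a x : Rd R d) : tdot (tneg a) x = - tdot a x.
Proof. by rewrite -sumrN; apply: eq_bigr => i _; rewrite tnth_mktuple mulNr. Qed.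

Lemma tdotZr (a x : Rd R d) (r : R) : tdot a (tscale r x) = r * tdot a x.
Proof. by rewrite mulr_sumr; apply: eq_bigr => i _; rewrite tnth_mktuple mulrCA. Qed.

Lemma tdot0l (x : Rd R d) : tdot [tuple 0 | i < d] x = 0.
Proof. by rewrite /tdot big1// => i _; rewrite tnth_mktuple mul0r. Qed.

Lemma expiD (a b : R) : expi (a + b) = expi a * expi b.
Proof. by rewrite /expi cosD sinD; apply/eqP; rewrite eq_complex /=;
  apply/andP; split; apply/eqP; ring. Qed.

Lemma expi0 : expi (0 : R) = 1.
Proof. by rewrite /expi cos0 sin0. Qed.

Lemma cabs_expi (r : R) : cabs (expi r) = 1.
Proof. by rewrite /cabs /= cos2Dsin2 sqrtr1. Qed.

Lemma cabs_normc z : cabs z = Normc.normc z.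
Proof. by case: z. Qed.

Lemma cabsM z w : cabs (z * w) = cabs z * cabs w.
Proof. by rewrite !cabs_normc Normc.normcM. Qed.

Lemma cabsD z w : cabs (z + w) <= cabs z + cabs w.
Proof. by rewrite !cabs_normc le_normcD. Qed.

Lemma cabs0 : cabs (0 : C) = 0.
Proof. by rewrite /cabs /= expr0n /= addr0 sqrtr0. Qed.

Lemma cabs_conj z : cabs z^*%C = cabs z.
Proof. by case: z => a b; rewrite /cabs /= sqrrN. Qed.

Lemma cabs_sum (I : Type) (r : seq I) (P : pred I) (F : I -> C) :
  cabs (\sum_(i <- r | P i) F i) <= \sum_(i <- r | P i) cabs (F i).
Proof.
elim/big_rec2: _ => [|i y1 y2 _ H]; first by rewrite cabs0.
by apply: le_trans (cabsD _ _) _; rewrite lerD2l.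
Qed.

Lemma UM lam mu f : U lam (U mu f) =
  fun x => expi (- tdot mu.2 lam.1) * U (add2 lam mu) f x.
Proof.
apply/funext => x; rewrite /U /= tdotBr tsubD tdotDl !expiD; ring.
Qed.

(** Points may repeat in the list, so sums and products of operators are plain list operations;
    [coef] does the merging. *)
Definition op s f : Fun := fun x => \sum_(p <- s) p.1 * U p.2 f x.

(** The phase comes from moving a translation past a modulation, as in [UM]. It is unimodular, hence
    invisible to weighted norms. *)
Definition mulp (p q : C * L) : C * L :=
  (p.1 * q.1 * expi (- tdot q.2.2 p.2.1), add2 p.2 q.2).

Definition mult s t : terms := [seq mulp p q | p <- s, q <- t].

(** A shift is unitary, so its adjoint is its inverse, which is the opposite shift up to a phase. *)
Definition adjp (p : C * L) : C * L :=
  (p.1^*%C * expi (- tdot p.2.2 p.2.1), neg2 p.2).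

Definition adj s : terms := map adjp s.

Definition scal a s : terms := [seq (a * p.1, p.2) | p <- s].

Lemma UZ lam a f : U lam (fun x => a * f x) = fun x => a * U lam f x.
Proof. by apply/funext => x; rewrite /U mulrCA. Qed.

Lemma UD lam f g : U lam (fun x => f x + g x) = fun x => U lam f x + U lam g x.
Proof. by apply/funext => x; rewrite /U mulrDr. Qed.

Lemma U_sum lam (I : Type) (r : seq I) (F : I -> Fun) :
  U lam (fun x => \sum_(i <- r) F i x) = fun x => \sum_(i <- r) U lam (F i) x.
Proof. by apply/funext => x; rewrite /U mulr_sumr. Qed.

Lemma op_cat s t f x : op (s ++ t) f x = op s f x + op t f x.
Proof. by rewrite /op big_cat. Qed.

Lemma op_scal a s f x : op (scal a s) f x = a * op s f x.
Proof. by rewrite /op big_map mulr_sumr; apply: eq_bigr => p _; rewrite mulrA. Qed.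

Lemma op_mult s t f : op (mult s t) f = op s (op t f).
Proof.
apply/funext => x; rewrite /op /mult big_allpairs_dep /=.
apply: eq_bigr => p _; rewrite U_sum /= mulr_sumr; apply: eq_bigr => q _.
rewrite UZ UM /= /mulp /=; ring.
Qed.

Lemma L2op s f : L2 f -> L2 (op s f).
Proof. by move=> Lf; apply: L2_sum => p; apply: L2Z; exact: L2U. Qed.

Lemma opD s f g : op s (fun x => f x + g x) = fun x => op s f x + op s g x.
Proof.
apply/funext => x; rewrite /op -big_split; apply: eq_bigr => p _.
by rewrite UD /= mulrDr.
Qed.

Lemma opZ s a f : op s (fun x => a * f x) = fun x => a * op s f x.
Proof.
apply/funext => x; rewrite /op mulr_sumr; apply: eq_bigr => p _.
by rewrite UZ mulrCA.
Qed.

Lemma opB s f g : op s (fun x => f x - g x) = fun x => op s f x - op s g x.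
Proof.
rewrite (_ : (fun x => f x - g x) = fun x => f x + -1 * g x); last first.
  by apply/funext => x; rewrite mulN1r.
by rewrite opD opZ; apply/funext => x; rewrite mulN1r.
Qed.

Lemma op_le s f : L2 f -> nrm2 (op s f) <= (\sum_(p <- s) cabs p.1) * nrm2 f.
Proof.
move=> Lf; elim: s => [|p s IH].
  rewrite big_nil mul0r (_ : op [::] f = fun=> 0) ?nrm20//.
  by apply/funext => x; rewrite /op big_nil.
rewrite big_cons mulrDl (_ : op (p :: s) f = fun x => p.1 * U p.2 f x + op s f x); last first.
  by apply/funext => x; rewrite /op big_cons.
have LU := L2U p.2 Lf.
apply: le_trans (nrm2D _ _) _; [exact: L2Z|exact: L2op|].
by rewrite lerD// nrm2Z// nrm2U.
Qed.

Lemma U_adj lam f g : L2 f -> L2 g ->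
  ip (U lam f) g = ip f (fun x => expi (- tdot lam.2 lam.1) * U (neg2 lam) g x).
Proof.
move=> Lf Lg.
have LUg : L2 (fun x => expi (- tdot lam.2 lam.1) * U (neg2 lam) g x).
  by apply: L2Z; exact: L2U.
rewrite -(ipU lam Lf LUg); congr ip.
rewrite UZ UM; apply/funext => x.
rewrite mulrA -expiD /= tdotNl opprK addNr expi0 mul1r /U /=.
by rewrite !taddNr tdot0l tsub0 expi0 mul1r.
Qed.

Lemma ip_sumr (I : Type) (r : seq I) (F : I -> Fun) f : L2 f -> (forall i, L2 (F i)) ->
  ip f (fun x => \sum_(i <- r) F i x) = \sum_(i <- r) ip f (F i).
Proof.
move=> Lf LF; elim: r => [|i r IH].
  rewrite big_nil; have -> : (fun x : Rd R d => \sum_(i <- [::]) F i x) = fun x => 0%:C%C * f x.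
    by apply/funext => x; rewrite big_nil mul0r.
  by rewrite ipZr// mul0r.
rewrite big_cons -IH -ipDr//; last exact: L2_sum.
by congr ip; apply/funext => x; rewrite big_cons.
Qed.

Lemma op_adj s f g : L2 f -> L2 g -> ip (op s f) g = ip f (op (adj s) g).
Proof.
move=> Lf Lg; rewrite ipC ip_sumr//; last by move=> p; apply: L2Z; exact: L2U.
rewrite ip_sumr//; last by move=> p; apply: L2Z; exact: L2U.
rewrite /adj big_map; apply: eq_bigr => p _.
have LU := L2U p.2 Lf.
rewrite ipC ipM U_adj//; last exact: L2Z.
by congr ip; apply/funext => x; rewrite UZ /adjp /=; ring.
Qed.

Lemma nrm2_sum_le (I : Type) (r : seq I) (F : I -> Fun) : (forall i, L2 (F i)) ->
  nrm2 (fun x => \sum_(i <- r) F i x) <= \sum_(i <- r) nrm2 (F i).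
Proof.
move=> LF; elim: r => [|i r IH].
  rewrite (_ : (fun x => _) = fun=> 0) ?nrm20 ?big_nil//.
  by apply/funext => x; rewrite big_nil.
rewrite big_cons (_ : (fun x => _) = fun x => F i x + \sum_(j <- r) F j x); last first.
  by apply/funext => x; rewrite big_cons.
apply: le_trans (nrm2D _ _) _ => //; first exact: L2_sum.
by rewrite lerD2l.
Qed.

Definition supp s : seq L := undup (map snd s).
Definition coef s nu : C := \sum_(p <- s | p.2 == nu) p.1.

(** [F] may exceed the support, where [coef] vanishes; the final convergence argument takes an
    initial segment of an enumeration. *)
Lemma op_supp s f x (F : seq L) : uniq F -> {subset map snd s <= F} ->
  op s f x = \sum_(nu <- F) coef s nu * U nu f x.
Proof.
move=> uF sF; rewrite /op /coef.
under [RHS]eq_bigr do rewrite mulr_suml.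
rewrite (exchange_big_dep xpredT)//= big_seq [RHS]big_seq; apply: eq_bigr => p ps.
have pF : p.2 \in F by apply: sF; exact: map_f.
by rewrite big_eq_seq ?pF.
Qed.

Lemma coef_cat s t nu : coef (s ++ t) nu = coef s nu + coef t nu.
Proof. by rewrite /coef big_cat. Qed.

Variable v : L -> R.
Hypothesis v_ge0 : forall nu, 0 <= v nu.

Definition wnorm s : R := \sum_(p <- s) v p.2 * cabs p.1.

Lemma wnorm_ge0 s : 0 <= wnorm s.
Proof. by apply: sumr_ge0 => p _; rewrite mulr_ge0// cabs_ge0. Qed.

Lemma sum_coef_le_wnorm s (F : seq L) : uniq F ->
  \sum_(nu <- F) v nu * cabs (coef s nu) <= wnorm s.
Proof.
move=> uF.
apply: (@le_trans _ _ (\sum_(nu <- F) \sum_(p <- s | p.2 == nu) v p.2 * cabs p.1)).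
  apply: ler_sum => nu _; rewrite (eq_bigr (fun p => v nu * cabs p.1)); last first.
    by move=> p /eqP ->.
  by rewrite -mulr_sumr ler_wpM2l// cabs_sum.
rewrite (exchange_big_dep xpredT)//= ; apply: ler_sum => p _.
rewrite big_eq_seq//; case: ifP => // _.
by rewrite mulr_ge0// cabs_ge0.
Qed.

Lemma wnorm_mult s t : (forall x y : L, v (add2 x y) <= v x * v y) ->
  wnorm (mult s t) <= wnorm s * wnorm t.
Proof.
move=> vsub; rewrite /wnorm /mult big_allpairs_dep /= mulr_suml.
apply: ler_sum => p _; rewrite mulr_sumr; apply: ler_sum => q _.
rewrite /= !cabsM cabs_expi mulr1 mulrACA ler_wpM2r ?mulr_ge0 ?cabs_ge0//.
Qed.

Definition collect s : terms := [seq (coef s nu, nu) | nu <- supp s].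

Lemma op_collect s f : op (collect s) f = op s f.
Proof.
apply/funext => x; rewrite [RHS](op_supp f x (undup_uniq (map snd s))); last first.
  by move=> y; rewrite mem_undup.
by rewrite /op big_map.
Qed.

End FormalSums.

(** * Bounding coefficients by the operator norm *)

Section Parseval.
Variables (R : realType) (d : nat).
Local Notation C := R[i].
Local Notation Fun := (Rd R d -> C).
Local Notation L := (Rdd R d).
Local Notation terms := (seq (C * Rdd R d)).
Implicit Types (f g h : Fun) (lam mu nu : L) (z w a : C) (s t : terms).

Lemma ReD z w : complex.Re (z + w) = complex.Re z + complex.Re w.
Proof. by case: z w => [? ?] [? ?]. Qed.

Lemma Re_sum (I : Type) (r : seq I) (P : pred I) (F : I -> C) :
  complex.Re (\sum_(i <- r | P i) F i) = \sum_(i <- r | P i) complex.Re (F i).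
Proof. by elim/big_rec2: _ => [//|i y1 y2 _ <-]; rewrite ReD. Qed.

Lemma ReZ (r : R) z : complex.Re (r%:C%C * z) = r * complex.Re z.
Proof. by case: z => a b; rewrite /= mul0r subr0. Qed.

(* Averaging over [mu] and [mu + mu0], where [phi p mu0 = pi], kills the frequency
   [p] and keeps the diagonal: a finite substitute for the mean value of an almost
   periodic function. *)
Lemma trig_mean (I : eqType) (P : seq I) (phi : I -> L -> R) (dg : pred I) (M : R) :
  (forall p mu nu, phi p (add2 mu nu) = phi p mu + phi p nu) ->
  (forall p mu, dg p -> phi p mu = 0) ->
  (forall p, ~~ dg p -> exists mu, phi p mu = pi) ->
  forall b : I -> C,
  (forall mu, \sum_(p <- P) complex.Re (b p * expi (phi p mu)) <= M) ->
  \sum_(p <- P | dg p) complex.Re (b p) <= M.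
Proof.
move=> phiD phi0 phipi.
(* [T] lists the off-diagonal indices whose coefficient may still be nonzero. Once it is empty only
   the diagonal is left, and any evaluation point will do. *)
suff H (T : seq I) : forall b : I -> C,
    (forall p, p \in P -> ~~ dg p -> p \notin T -> b p = 0) ->
    (forall mu, \sum_(p <- P) complex.Re (b p * expi (phi p mu)) <= M) ->
    \sum_(p <- P | dg p) complex.Re (b p) <= M.
  by move=> b; apply: (H P) => p ->.
elim: T => [|p0 T IH] b bT bM.
  apply: le_trans (bM (zero2 R d)); rewrite big_mkcond le_eqVlt; apply/orP; left.
  apply/eqP; rewrite big_seq [RHS]big_seq; apply: eq_bigr => p pP.
  by case: ifPn => pd; [rewrite phi0// expi0 mulr1|rewrite bT// mul0r].
have [p0d|p0d] := boolP (dg p0).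
  apply: IH => // p pP pd pT; apply: bT => //; rewrite inE negb_or pT andbT.
  by apply: contraNneq pd => ->.
have [mu0 mu0E] := phipi _ p0d.
(* Averaging multiplies each coefficient by a fixed number: 1 on the diagonal, 0 at [p0].
   Coefficients that were already zero stay zero, so [T] shrinks. *)
pose b' p := (2^-1)%:C%C * (b p * (1 + expi (phi p mu0))).
rewrite (eq_bigr (fun p => complex.Re (b' p))); last first.
  move=> p pd; by rewrite /b' phi0// expi0 ReZ mulrDr mulr1 ReD; field.
apply: IH => [p pP pd pT|mu].
  have [->|pp0] := eqVneq p p0.
    rewrite /b' mu0E [expi pi](_ : _ = -1); last by rewrite /expi cospi sinpi;
      apply/eqP; rewrite eq_complex /= oppr0 !eqxx.
    by rewrite subrr !mulr0.
  by rewrite /b' bT ?mul0r ?mulr0// inE negb_or pp0.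
rewrite (eq_bigr (fun p => 2^-1 * (complex.Re (b p * expi (phi p mu)) + complex.Re (b p
  * expi (phi p (add2 mu mu0)))))); last first.
  move=> p _; rewrite /b' -mulrA ReZ -ReD phiD expiD; congr (_ * complex.Re _); ring.
rewrite -mulr_sumr big_split /=.
have := bM mu; have := bM (add2 mu mu0); lra.
Qed.

(** The symplectic form, which is the phase picked up when two shifts are exchanged ([UC]). *)
Definition symp nu mu : R := tdot nu.2 mu.1 - tdot mu.2 nu.1.

Lemma tdotDr (a x y : Rd R d) : tdot a (tadd x y) = tdot a x + tdot a y.
Proof. by rewrite tdotC tdotDl !(tdotC a). Qed.

Lemma tdotZl (a x : Rd R d) (r : R) : tdot (tscale r x) a = r * tdot x a.
Proof. by rewrite tdotC tdotZr tdotC. Qed.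

Lemma sympD nu mu mu' : symp nu (add2 mu mu') = symp nu mu + symp nu mu'.
Proof. by rewrite /symp /= tdotDr tdotDl; ring. Qed.

Lemma UC nu mu f : U nu (U mu f) = fun x => expi (symp nu mu) * U mu (U nu f) x.
Proof.
by rewrite !UM; apply/funext => x; rewrite mulrA -expiD add2C /symp addrAC subrr add0r.
Qed.

Lemma tdot_ge0 (x : Rd R d) : 0 <= tdot x x.
Proof. by apply: sumr_ge0 => i _; rewrite -expr2 sqr_ge0. Qed.

Lemma tdot_eq0 (x : Rd R d) : tdot x x = 0 -> forall i, tnth x i = 0.
Proof.
move=> /eqP; rewrite psumr_eq0 => [/allP H i|i _]; last by rewrite -expr2 sqr_ge0.
by have := H i (mem_index_enum _); rewrite -expr2 sqrf_eq0 => /eqP.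
Qed.

(** Nondegeneracy of the symplectic form: rotating [nu - nu'] by the symplectic matrix yields a
    point that pairs with it to its squared norm [N], and the factor [pi / N] normalizes. *)
Lemma symp_separates nu nu' : nu != nu' -> exists mu, symp nu mu - symp nu' mu = pi.
Proof.
move=> nn; pose D1 := tsub nu.1 nu'.1; pose D2 := tsub nu.2 nu'.2.
pose N := tdot D1 D1 + tdot D2 D2.
have N0 : N != 0.
  apply: contraNneq nn => /eqP; rewrite paddr_eq0 ?tdot_ge0// => /andP[/eqP/tdot_eq0 e1
    /eqP/tdot_eq0 e2].
  rewrite [nu]surjective_pairing [nu']surjective_pairing; apply/eqP; congr pair;
    apply: eq_from_tnth => i; apply/eqP; rewrite -subr_eq0.
    by rewrite -(e1 i) tnth_mktuple.
  by rewrite -(e2 i) tnth_mktuple.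
exists (tscale (pi / N) D2, tscale (- (pi / N)) D1).
rewrite /symp /= !tdotZr !tdotZl (tdotC D1 nu.1) (tdotC D1 nu'.1).
transitivity (pi / N * (tdot nu.2 D2 - tdot nu'.2 D2 + (tdot nu.1 D1 - tdot nu'.1 D1))).
  ring.
by rewrite -!tdotBl -/D1 -/D2 (addrC (tdot D2 D2)) -/N mulfVK.
Qed.

(** The usual complex inner product, linear in [f]; multiplying [f] by ['i] turns the imaginary part
    into minus the real part. *)
Definition hermitian_ip f g : C := Complex (ip f g) (- ip (fun x => 'i%C * f x) g).

Lemma ip_hermitian z f g : L2 f -> L2 g -> ip (fun x => z * f x) g = complex.Re (z
  * hermitian_ip f g).
Proof.
move=> Lf Lg; case: z => a b.
have -> : (fun x => Complex a b * f x) = fun x => a%:C%C * f x + b%:C%C * ('i%C * f x).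
  apply/funext => x; rewrite mulrA -mulrDl; congr (_ * _); apply/eqP.
  by rewrite eq_complex /=; apply/andP; split; apply/eqP; ring.
have Li := L2Z 'i%C Lf.
by rewrite ipDl ?ipZl//; try exact: L2Z; rewrite /= mulrN opprK.
Qed.

Lemma conj_expi (r : R) : (expi r)^*%C = expi (- r).
Proof. by rewrite /expi cosN sinN. Qed.

Lemma conjM z w : (z * w)^*%C = z^*%C * w^*%C.
Proof. exact: rmorphM. Qed.

(* [nrm2 (op s (U mu f)) ^+ 2] is a trigonometric polynomial in [mu] whose mean is
   the sum of the squared coefficients, when [f] is a unit vector. *)
Lemma parseval s (K : R) : 0 <= K ->
  (forall f, L2 f -> nrm2 (op s f) <= K * nrm2 f) ->
  \sum_(nu <- supp s) cabs (coef s nu) ^+ 2 <= K ^+ 2.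
Proof.
move=> K0 sK; set F := supp s.
have uF : uniq F by exact: undup_uniq.
have [f Lf f1] := exists_L2_unit R d.
pose b (p : L * L) := (coef s p.2)^*%C * coef s p.1 * hermitian_ip (U p.1 f) (U p.2 f).
pose phi (p : L * L) mu := symp p.1 mu - symp p.2 mu.
have LU nu : L2 (U nu f) by exact: L2U.
have -> : \sum_(nu <- F) cabs (coef s nu) ^+ 2 =
    \sum_(p <- [seq (nu, nu') | nu <- F, nu' <- F] | p.1 == p.2) complex.Re (b p).
  rewrite [RHS]big_mkcond [RHS]big_allpairs_dep /= big_seq [RHS]big_seq; apply: eq_bigr => nu nuF.
  rewrite -big_mkcond /= big_eq_seq// nuF /b /=.
  rewrite (_ : _ * coef s nu = (cabs (coef s nu) ^+ 2)%:C%C).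
    by rewrite ReZ /= -nrm2_sqr// nrm2U// f1 expr1n mulr1.
  rewrite cabs_sqr; case: (coef s nu) => u w; apply/eqP; rewrite eq_complex /dotc /=.
  by apply/andP; split; apply/eqP; ring.
apply: (@trig_mean _ _ phi (fun p => p.1 == p.2)).
- by move=> p mu nu; rewrite /phi !sympD; ring.
- by move=> p mu /eqP e; rewrite /phi e subrr.
- by move=> p; exact: symp_separates.
move=> mu; have LUmu := L2U mu Lf.
apply: (@le_trans _ _ (nrm2 (op s (U mu f)) ^+ 2)); last first.
  rewrite ler_pXn2r ?nnegrE ?nrm2_ge0//.
  by apply: le_trans (sK _ LUmu) _; rewrite nrm2U// f1 mulr1.
pose G nu x := coef s nu * expi (symp nu mu) * U nu f x.
have LG nu : L2 (G nu) by exact: L2Z.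
(* Conjugation by [U mu] only multiplies each coefficient by a phase; the outer isometry [U mu] then
   drops out of the norm. *)
have -> : op s (U mu f) = U mu (fun x => \sum_(nu <- F) G nu x).
  rewrite U_sum; apply/funext => x; rewrite (op_supp _ _ uF); last first.
    by move=> y; rewrite mem_undup.
  apply: eq_bigr => nu _; rewrite UC mulrA -[RHS]/(U mu (G nu) x) /G UZ //.
rewrite nrm2U; last exact: L2_sum.
rewrite nrm2_sqr; last exact: L2_sum.
rewrite ip_sumr//; last exact: L2_sum.
under [X in _ <= X]eq_bigr do rewrite ipC ip_sumr//.
rewrite big_allpairs_dep /= le_eqVlt; apply/orP; left; apply/eqP.
apply: eq_bigr => nu _; apply: eq_bigr => nu' _.
rewrite [RHS]ipC [RHS]ipM [RHS]ipC.
have -> : (fun x => (coef s nu' * expi (symp nu' mu))^*%C * G nu x) = fun x =>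
    ((coef s nu')^*%C * coef s nu * expi (phi (nu, nu') mu)) * U nu f x.
  apply/funext => x; rewrite /G conjM conj_expi /phi /= expiD; ring.
by rewrite ip_hermitian// /b /= mulrAC.
Qed.

(** The norm of a self-adjoint operator is bounded by its numerical radius. *)
Lemma selfadjoint_norm s (q : R) : 0 <= q ->
  (forall f g, L2 f -> L2 g -> ip (op s f) g = ip f (op s g)) ->
  (forall f, L2 f -> `|ip (op s f) f| <= q * ip f f) ->
  forall f, L2 f -> nrm2 (op s f) <= q * nrm2 f.
Proof.
move=> q0 sa sq f Lf.
(* Subtract the quadratic forms at [f + g] and [f - g], then use the parallelogram law. *)
have key g : L2 g -> 2 * ip (op s f) g <= q * (ip f f + ip g g).
  move=> Lg; have Lfg := L2D Lf Lg; have Lfmg := L2B Lf Lg.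
  have LN := L2Z (-1)%:C%C Lg.
  have BE : (fun x => f x - g x) = fun x => f x + (-1)%:C%C * g x.
    by apply/funext => x; rewrite rmorphN1 mulN1r.
  have /ler_normlP[_ H1] := sq _ Lfg; have /ler_normlP[H2 _] := sq _ Lfmg.
  move: H1 H2; rewrite BE !opD opZ.
  have Lsf := L2op s Lf; have Lsg := L2op s Lg; have LsN := L2Z (-1)%:C%C Lsg.
  rewrite !ipDl ?ipDr ?ipZl ?ipZr//; try exact: L2D.
  rewrite (sa g f)// (ipC g (op s f)) (ipC g f).
  rewrite !mulrDr; lra.
have Lsf := L2op s Lf.
(* Taking [g] to be [t] times [op s f] in [key] gives a quadratic in [t] that is nonnegative
   everywhere. *)
have H : ip (op s f) (op s f) ^+ 2 <= (q * ip f f) * (q * ip (op s f) (op s f)).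
  rewrite -sqrrN; apply: quadratic_le; rewrite ?mulr_ge0 ?ip_ge0//.
  move=> t; have := key _ (L2Z t%:C%C Lsf).
  rewrite !ipZr ?ipZl//; last exact: L2Z.
  rewrite -subr_ge0; congr (_ <= _); ring.
rewrite -(@ler_pXn2r _ 2) ?nnegrE ?mulr_ge0 ?nrm2_ge0//.
rewrite exprMn !nrm2_sqr//; have := ip_ge0 (op s f); rewrite le_eqVlt => /orP[/eqP <-|pos].
  by rewrite mulr_ge0 ?sqr_ge0 ?ip_ge0.
rewrite -(ler_pM2r pos) -expr2; apply: le_trans H _.
by rewrite le_eqVlt; apply/orP; left; apply/eqP; ring.
Qed.

End Parseval.

(** * The Euclidean norm on the time-frequency plane *)

Section Geometry.
Variables (R : realType) (d : nat).
Local Notation L := (Rdd R d).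
Implicit Types (x y : L).

Lemma norm2_ge0 x : 0 <= norm2 x. Proof. exact: sqrtr_ge0. Qed.

Lemma norm2_neg x : norm2 (neg2 x) = norm2 x.
Proof. by rewrite /norm2 /= !tdotNl ![tdot _ (tneg _)]tdotC !tdotNl !opprK. Qed.

Lemma norm2_zero : norm2 (zero2 R d) = 0.
Proof. by rewrite /norm2 /= !tdot0l addr0 sqrtr0. Qed.

Lemma norm2_sqr x : norm2 x ^+ 2 = tdot x.1 x.1 + tdot x.2 x.2.
Proof. by rewrite sqr_sqrtr// addr_ge0 ?tdot_ge0. Qed.

Lemma norm2D x y : norm2 (add2 x y) <= norm2 x + norm2 y.
Proof.
pose dt x y := tdot x.1 y.1 + tdot x.2 y.2.
have CS : dt x y ^+ 2 <= dt x x * dt y y.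
  apply: quadratic_le; rewrite ?addr_ge0 ?tdot_ge0// => t.
  have := addr_ge0 (tdot_ge0 (tadd x.1 (tscale t y.1))) (tdot_ge0 (tadd x.2 (tscale t y.2))).
  rewrite !tdotDl !tdotDr !tdotZl !tdotZr (tdotC y.1 x.1) (tdotC y.2 x.2).
  by congr (_ <= _); rewrite /dt; ring.
rewrite -(@ler_pXn2r _ 2) ?nnegrE ?addr_ge0 ?norm2_ge0//.
rewrite sqrrD !norm2_sqr /= !tdotDl !tdotDr (tdotC y.1 x.1) (tdotC y.2 x.2).
have : dt x y <= norm2 x * norm2 y.
  apply: le_trans (ler_norm _) _.
  rewrite -(@ler_pXn2r _ 2) ?nnegrE ?mulr_ge0 ?norm2_ge0//.
  by rewrite exprMn !norm2_sqr real_normK ?num_real.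
rewrite /dt; lra.
Qed.

End Geometry.

(** * Counting the points of the powers *)

Section Counting.
Variables (R : realType) (d n0 : nat).
Local Notation N := n0.+1.
Local Notation C := R[i].
Local Notation L := (Rdd R d).
Local Notation terms := (seq (C * Rdd R d)).
Variable lam : 'I_N -> L.

(** [a j] and [b j] count the occurrences of [lam j] with plus and minus sign. Recording
    multiplicities rather than words makes the count polynomial in [n]. *)
Definition comb (a b : 'I_N -> nat) : L :=
  ([tuple \sum_(j < N) ((a j)%:R - (b j)%:R) * tnth (lam j).1 i | i < d],
   [tuple \sum_(j < N) ((a j)%:R - (b j)%:R) * tnth (lam j).2 i | i < d]).

Lemma comb_incr (a b : 'I_N -> nat) (k l : 'I_N) :
  comb (fun j => (j == k) + a j)%N (fun j => (j == l) + b j)%N =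
  add2 (add2 (neg2 (lam l)) (lam k)) (comb a b).
Proof.
have E (F : 'I_N -> R) k' : \sum_(j < N) (j == k')%:R * F j = F k'.
  rewrite (bigD1 k')//= eqxx mul1r big1 ?addr0// => j /negbTE ->.
  by rewrite mul0r.
congr pair; apply: eq_from_tnth => i; rewrite !tnth_mktuple.
  rewrite -(E (fun j => tnth (lam j).1 i) k) -(E (fun j => tnth (lam j).1 i) l).
  rewrite -sumrN -!big_split /=; apply: eq_bigr => j _; rewrite !natrD; ring.
rewrite -(E (fun j => tnth (lam j).2 i) k) -(E (fun j => tnth (lam j).2 i) l).
rewrite -sumrN -!big_split /=; apply: eq_bigr => j _; rewrite !natrD; ring.
Qed.

Definition balanced (n : nat) (x : L) := exists a b : 'I_N -> nat,
  [/\ (\sum_j a j = n)%N, (\sum_j b j = n)%N & x = comb a b].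

Lemma balanced0 : balanced 0 (zero2 R d).
Proof.
exists (fun=> 0%N), (fun=> 0%N); split; rewrite ?big1//.
by congr pair; apply: eq_from_tnth => i; rewrite !tnth_mktuple big1// => j _; rewrite subrr mul0r.
Qed.

Lemma balancedS (n : nat) (x : L) (k l : 'I_N) : balanced n x ->
  balanced n.+1 (add2 (add2 (neg2 (lam l)) (lam k)) x).
Proof.
move=> [a [b [an bn ->]]].
have E (k' : 'I_N) : (\sum_j (j == k' : nat))%N = 1%N.
  by rewrite (bigD1 k')//= eqxx big1 // => j /negbTE ->.
exists (fun j => (j == k) + a j)%N, (fun j => (j == l) + b j)%N.
by split; rewrite ?big_split/= ?E ?an ?bn// comb_incr.
Qed.

Lemma balanced_size (n : nat) (F : seq L) : uniq F ->
  (forall x, x \in F -> balanced n x) -> (size F <= 'C(n + n0, n0) ^ 2)%N.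
Proof.
(* A multiplicity never exceeds the total [n], so it fits in ['I_n.+1] and the vectors form a finite
   type. *)
move=> uF bF; pose A := [set t : n0.+1.-tuple 'I_n.+1 | (\sum_(i <- t) i)%N == n]%SET.
pose f (p : n0.+1.-tuple 'I_n.+1 * n0.+1.-tuple 'I_n.+1) :=
  comb (fun j => tnth p.1 j) (fun j => tnth p.2 j).
have tupleE (a : 'I_N -> nat) : (\sum_j a j = n)%N ->
    exists2 t, t \in A & forall j, tnth t j = a j :> nat.
  move=> an; exists [tuple inord (a j) | j < N]; last first.
    move=> j; rewrite tnth_mktuple inordK// ltnS -an (bigD1 j)//=; exact: leq_addr.
  rewrite inE big_tuple -[X in _ == X]an; apply/eqP; apply: eq_bigr => j _.
  rewrite tnth_mktuple inordK// ltnS -an (bigD1 j)//=; exact: leq_addr.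
have sub : {subset F <= map f (enum (finset.setX A A))}.
  move=> x xF; have [a [b [an bn ->]]] := bF _ xF.
  have [t tA ta] := tupleE _ an; have [u uA ub] := tupleE _ bn.
  apply/mapP; exists (t, u); first by rewrite mem_enum finset.in_setX tA.
  by rewrite /f /=; congr comb; apply/funext => j; rewrite ?ta ?ub.
apply: leq_trans (uniq_leq_size uF sub) _.
by rewrite size_map -cardE cardsX card_ord_partitions mulnn addnC.
Qed.

End Counting.

(** * The Neumann series *)

Section Series.
Variable R : realType.

(** The negative binomial series, truncated: by Pascal's rule a factor [1 - q] lowers [M] by one,
    and the boundary term it leaves has the favourable sign. *)
Lemma sum_binomial_geometric (q : R) (M K : nat) : 0 <= q ->  q <= 1 ->
  (1 - q) ^+ M.+1 * \sum_(n < K) 'C(n + M, M)%:R * q ^+ n <= 1.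
Proof.
move=> q0 q1; elim: M => [|M IH].
  rewrite expr1; under eq_bigr do rewrite addn0 bin0 mul1r.
  by rewrite -opprB mulNr -subrX1 opprB lerBlDr lerDl exprn_ge0.
have E : (1 - q) * \sum_(n < K) 'C(n + M.+1, M.+1)%:R * q ^+ n =
    \sum_(n < K) 'C(n + M, M)%:R * q ^+ n - 'C(K + M, M.+1)%:R * q ^+ K.
  elim: K {IH} => [|K IH].
    by rewrite !big_ord0 add0n bin_small// mul0r mulr0 subr0.
  by rewrite !big_ord_recr /= mulrDr IH (addnS K M) (addSn K M) !binS !natrD exprS; ring.
rewrite exprSr -mulrA E mulrBr; apply: le_trans IH.
by rewrite gerBl !mulr_ge0 ?exprn_ge0 ?subr_ge0.
Qed.

(** On the right stands a falling factorial with [m] more factors than [(n + k) ^_ k], each at least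
    [n.+1]. *)
Lemma expn_bin_le (n m k : nat) :
  (n.+1 ^ m * 'C(n + k, k) <= (m + k)`! * 'C(n + (m + k), m + k))%N.
Proof.
rewrite [X in (_ <= X)%N]mulnC bin_ffact.
apply: (@leq_trans (n.+1 ^ m * (n + k) ^_ k)).
  by rewrite leq_mul2l -bin_ffact leq_pmulr ?fact_gt0 ?orbT.
elim: m => [|m IH]; first by rewrite expn0 mul1n.
rewrite expnS addSn addnS ffactSS -mulnA leq_mul// ltnS leq_addr//.
Qed.

(** Used with [k = N - 1]. The argument yields [(m + k)!], which is rounded up to the factorial of
    the final bound. *)
Lemma sum_poly_geometric (q : R) (m k K : nat) : 0 <= q -> q < 1 ->
  \sum_(n < K) (1 + n%:R) ^+ m * 'C(n + k, k)%:R * q ^+ n <=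
  (m + k.+1)`!%:R * (1 - q) ^- (m + k.+1).
Proof.
move=> q0 q1; have q1' : 0 < 1 - q by rewrite subr_gt0.
apply: (@le_trans _ _ ((m + k)`!%:R * \sum_(n < K) 'C(n + (m + k), m + k)%:R * q ^+ n)).
  rewrite mulr_sumr; apply: ler_sum => n _; rewrite mulrA ler_wpM2r ?exprn_ge0//.
  by rewrite nat1r -natrX -!natrM ler_nat expn_bin_le.
rewrite ler_pM ?ler0n//.
- by apply: sumr_ge0 => n _; rewrite mulr_ge0 ?exprn_ge0.
- by rewrite ler_nat addnS factS leq_pmull.
- rewrite -[leRHS]mul1r ler_pdivlMr ?exprn_gt0// mulrC addnS.
  exact: sum_binomial_geometric q0 (ltW q1).
Qed.

Lemma sum_sqr_le (I : Type) (F : seq I) (x : I -> R) :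
  (\sum_(i <- F) x i) ^+ 2 <= (size F)%:R * \sum_(i <- F) x i ^+ 2.
Proof.
apply: quadratic_le => //; last by apply: sumr_ge0 => i _; rewrite sqr_ge0.
move=> t; have : 0 <= \sum_(i <- F) (1 + t * x i) ^+ 2.
  by apply: sumr_ge0 => i _; rewrite sqr_ge0.
congr (_ <= _); rewrite -sum1_size natr_sum !mulr_sumr -!big_split /=.
by apply: eq_bigr => i _; ring.
Qed.

End Series.

(** * Operator norms, frame bounds and the residual *)

Section Opnorm.
Variables (R : realType) (d : nat).
Local Notation C := R[i].
Local Notation Fun := (Rd R d -> C).
Local Notation L := (Rdd R d).
Local Notation terms := (seq (C * Rdd R d)).
Implicit Types (f g h : Fun) (lam mu nu : L) (z w a : C) (s t : terms) (S : Fun -> Fun).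

(** [S] is homogeneous only up to null functions, so the statement is about norms. The additive term
    of linearity is the image of 0, which the bound makes null. *)
Lemma bounded_scale S a f : bounded_op S -> L2 f ->
  nrm2 (S (fun x => a * f x)) = cabs a * nrm2 (S f).
Proof.
move=> [SL [Slin [K SK]]] Lf; have L0 := L20 R d.
have S0 : nrm2 (S (fun=> 0)) = 0.
  by apply/eqP; rewrite eq_le nrm2_ge0 andbT (le_trans (SK _ L0))// nrm20 mulr0.
have LSf := SL _ Lf; have LS0 := SL _ L0; have LaS := L2Z a LSf.
have := Slin a f (fun=> 0) Lf L0.
rewrite (_ : (fun x => a * f x + 0) = fun x => a * f x); last first.
  by apply/funext => x; rewrite addr0.
move=> /nrm2_null -> //; [|exact/SL/L2Z|exact: L2D].
rewrite -nrm2Z//; apply: nrm2_null => //; first exact: L2D.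
rewrite -[RHS]S0; congr nrm2; apply/funext => x; rewrite /fsub addrC addrA.
by rewrite addNr add0r.
Qed.

Lemma opnorm_ub S f : bounded_op S -> L2 f -> nrm2 f <= 1 -> nrm2 (S f) <= opnorm S.
Proof.
move=> [SL [Slin [K SK]]] Lf f1; apply: ub_le_sup; last by exists f.
(* The bound [K] comes without a sign, hence the absolute value. *)
exists `|K| => _ [g [Lg [g1 ->]]]; apply: le_trans (SK _ Lg) _.
apply: (@le_trans _ _ (`|K| * nrm2 g)); first by rewrite ler_wpM2r ?nrm2_ge0// ler_norm.
by rewrite ler_piMr.
Qed.

Lemma opnorm_ge0 S : bounded_op S -> 0 <= opnorm S.
Proof.
move=> bS; apply: le_trans (opnorm_ub bS (L20 R d) _); rewrite ?nrm2_ge0//.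
by rewrite nrm20.
Qed.

Lemma opnorm_le S f : bounded_op S -> L2 f -> nrm2 (S f) <= opnorm S * nrm2 f.
Proof.
move=> bS Lf; have := nrm2_ge0 f; rewrite le_eqVlt => /orP[/eqP f0|f0].
  have [_ [_ [K SK]]] := bS.
  by apply: le_trans (SK _ Lf) _; rewrite -f0 !mulr0.
have Lg := L2Z (nrm2 f)^-1%:C%C Lf.
rewrite -ler_pdivrMr// mulrC -[X in X * _]ger0_norm ?invr_ge0 ?(ltW f0)//.
rewrite -(cabsr) -bounded_scale//; apply: opnorm_ub => //.
by rewrite nrm2Z// cabsr ger0_norm ?invr_ge0 ?(ltW f0)// mulVf ?gt_eqF.
Qed.

Lemma bounded_op_op s : bounded_op (op s).
Proof.
split; [exact: L2op|split]; last by exists (\sum_(p <- s) cabs p.1) => f; exact: op_le.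
move=> a f g Lf Lg; rewrite -[RHS](nrm20 R d); congr nrm2; apply/funext => x.
by rewrite /fsub opD opZ subrr.
Qed.

Lemma U0 f : U (zero2 R d) f = f.
Proof. by apply/funext => x; rewrite /U tdot0l expi0 mul1r tsub0. Qed.

Section Frame.
Variables (s : terms) (S : Fun -> Fun).
Hypothesis (HS : is_inverse (op s) S).

Lemma inverse_lower f : L2 f -> nrm2 f <= opnorm S * nrm2 (op s f).
Proof.
move=> Lf; have [bS [ST _]] := HS; have Lsf := L2op s Lf.
rewrite -(nrm2_null _ _ (ST _ Lf))//; first exact: opnorm_le.
by have [SL _] := bS; exact: SL.
Qed.

(** Makes [A] genuinely positive: inversion sends 0 to 0, so [A] would vanish along with
    [opnorm S]. *)
Lemma opnorm_inverse_gt0 : 0 < opnorm S.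
Proof.
have [f Lf f1] := exists_L2_unit R d; have [bS _] := HS.
rewrite lt_neqAle opnorm_ge0// andbT eq_sym; apply/negP => /eqP S0.
by have := inverse_lower Lf; rewrite S0 mul0r f1 ler10.
Qed.

Lemma inverse_nonnil : s != [::].
Proof.
have [f Lf f1] := exists_L2_unit R d; apply/eqP => s0.
have := inverse_lower Lf; rewrite f1 s0 (_ : op [::] f = fun=> 0).
  by rewrite nrm20 mulr0 ler10.
by apply/funext => x; rewrite /op big_nil.
Qed.

Let A := (opnorm S) ^- 2.
Let B := (opnorm (op s)) ^+ 2.
Let gam := 2 / (A + B).
Let q := (B - A) / (A + B).

Lemma frame_lower f : L2 f -> A * ip f f <= ip (op s f) (op s f).
Proof.
move=> Lf; have S0 := opnorm_inverse_gt0; have Lsf := L2op s Lf.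
rewrite /A mulrC ler_pdivrMr ?exprn_gt0// -!nrm2_sqr// -exprMn mulrC.
by rewrite ler_pXn2r ?nnegrE ?mulr_ge0 ?nrm2_ge0 ?(ltW S0)// inverse_lower.
Qed.

Lemma frame_upper f : L2 f -> ip (op s f) (op s f) <= B * ip f f.
Proof.
move=> Lf; have Lsf := L2op s Lf; have bs := bounded_op_op s.
rewrite -!nrm2_sqr// -exprMn ler_pXn2r ?nnegrE ?mulr_ge0 ?nrm2_ge0 ?opnorm_ge0//.
exact: opnorm_le.
Qed.

Lemma A_gt0 : 0 < A.
Proof. by rewrite /A invr_gt0 exprn_gt0 ?opnorm_inverse_gt0. Qed.

Lemma A_le_B : A <= B.
Proof.
have [f Lf f1] := exists_L2_unit R d.
have := le_trans (frame_lower Lf) (frame_upper Lf).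
by rewrite -nrm2_sqr// f1 expr1n !mulr1.
Qed.

Lemma q_ge0 : 0 <= q.
Proof. by rewrite divr_ge0 ?subr_ge0 ?A_le_B// addr_ge0 ?(ltW A_gt0)// (le_trans
  (ltW A_gt0) A_le_B). Qed.

(* [I - gam T^* T], a self-adjoint contraction of norm at most [q] when
   [A <= T^* T <= B]; [gam] is the optimal relaxation parameter. *)
Definition residual : terms := (1, zero2 R d) :: scal (- gam%:C%C) (mult (adj s) s).

Lemma op_residual f x : op residual f x = f x - gam%:C%C * op (adj s) (op s f) x.
Proof.
by rewrite -op_mult /residual -cat1s op_cat op_scal mulNr; congr (_ + _); rewrite
  /op big_seq1 /= mul1r U0.
Qed.

Lemma ip_residual f g : L2 f -> L2 g -> ip (op residual f) g = ip f g - gam * ip (op s f) (op s g).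
Proof.
move=> Lf Lg; have Lsf := L2op s Lf; have Lsg := L2op s Lg; have La := L2op (adj s) Lsf.
have -> : op residual f = fun x => f x + (- gam)%:C%C * op (adj s) (op s f) x.
  by apply/funext => x; rewrite op_residual rmorphN mulNr.
rewrite ipDl//; last exact: L2Z.
by rewrite ipZl// [X in _ + _ * X]ipC -op_adj// (ipC (op s g)) mulNr.
Qed.

Lemma residual_norm f : L2 f -> nrm2 (op residual f) <= q * nrm2 f.
Proof.
apply: selfadjoint_norm; first exact: q_ge0.
  by move=> {}f g Lf Lg; rewrite ip_residual// [RHS]ipC ip_residual// ipC (ipC (op s g)).
move=> {}f Lf; rewrite ip_residual//.
have A0 := A_gt0; have B0 := lt_le_trans A0 A_le_B; have AB0 := addr_gt0 A0 B0.
have Hl := frame_lower Lf; have Hu := frame_upper Lf.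
(* After multiplication by [A + B], the two sides of the absolute value are exactly twice the upper
   and the lower frame bound. *)
rewrite ler_norml -(ler_pM2r AB0) -[X in _ && X](ler_pM2r AB0).
rewrite /gam /q (_ : - (_ * _) * (A + B) = (A - B) * ip f f); last by field; rewrite gt_eqF.
rewrite (_ : (B - A) / (A + B) * ip f f * (A + B) = (B - A) * ip f f); last
  by field; rewrite gt_eqF.
rewrite (_ : (ip f f - _) * (A + B) = (A + B) * ip f f - 2 * ip (op s f) (op s f)); last
  by field; rewrite gt_eqF.
by apply/andP; split; lra.
Qed.

Definition residual_pow n : terms := iter n (mult residual) [:: (1, zero2 R d)].

Lemma op_residual_pow0 f : op (residual_pow 0) f = f.
Proof. by apply/funext => x; rewrite /op big_seq1 /= mul1r U0. Qed.

Lemma op_residual_powS n f : op (residual_pow n.+1) f = op residual (op (residual_pow n) f).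
Proof. by rewrite [residual_pow _]/= op_mult. Qed.

Lemma op_residual_powSr n f : op (residual_pow n.+1) f = op (residual_pow n) (op residual f).
Proof. by elim: n => [|n IH]; rewrite ?op_residual_powS ?op_residual_pow0// -IH
  -op_residual_powS. Qed.

Lemma residual_pow_norm n f : L2 f -> nrm2 (op (residual_pow n) f) <= q ^+ n * nrm2 f.
Proof.
move=> Lf; elim: n => [|n IH]; first by rewrite op_residual_pow0 mul1r.
rewrite op_residual_powS exprS -mulrA; apply: le_trans (residual_norm (L2op _ Lf)) _.
by rewrite ler_wpM2l ?q_ge0.
Qed.

Lemma residual_pow_coef n : \sum_(nu <- supp (residual_pow n)) cabs (coef
  (residual_pow n) nu) ^+ 2 <= (q ^+ n) ^+ 2.
Proof. by apply: parseval; [rewrite exprn_ge0 ?q_ge0|move=> f; exact: residual_pow_norm]. Qed.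

(* [gam (I - gam T^* T)^n T^*]. Merging equal points with [collect] before
   multiplying is what lets the weighted norm benefit from [parseval]. *)
Definition neumann_term n : terms := mult (collect (residual_pow n)) (scal gam%:C%C (adj s)).

Lemma op_neumann_term n f x : op (neumann_term n) f x = gam%:C%C * op (residual_pow n) (op
  (adj s) f) x.
Proof.
rewrite op_mult op_collect.
rewrite (_ : op (scal _ _) f = fun x => gam%:C%C * op (adj s) f x) ?opZ//.
by apply/funext => y; rewrite op_scal.
Qed.

(** Applied to [op s f], the n-th term is [W^n (I - W) f]. *)
Lemma neumann_telescope j f x :
  \sum_(n < j) op (neumann_term n) (op s f) x = f x - op (residual_pow j) f x.
Proof.
elim: j => [|j IH]; first by rewrite big_ord0 op_residual_pow0 subrr.
rewrite big_ord_recr /= IH op_neumann_term op_residual_powSr.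
have -> : op residual f = fun x => f x - gam%:C%C * op (adj s) (op s f) x.
  by apply/funext => y; rewrite op_residual.
rewrite opB opZ; ring.
Qed.

(** Telescoping at [S f] gives the remainder [W^j (S f)]. Since [op s (S f)] and [f] agree only up
    to a null function, so do the two partial sums. *)
Lemma partial_inverse j f : L2 f ->
  nrm2 (fun x => S f x - \sum_(n < j) op (neumann_term n) f x) <= q ^+ j * nrm2 (S f).
Proof.
move=> Lf; have [[SL _] [_ TS]] := HS; have LSf := SL _ Lf; have LTS := L2op s LSf.
have Lsum g : L2 g -> L2 (fun x => \sum_(n < j) op (neumann_term n) g x).
  by move=> Lg; apply: L2_sum => n; exact: L2op.
apply: le_trans (residual_pow_norm j LSf); rewrite le_eqVlt; apply/orP; left; apply/eqP.
apply: nrm2_null; [exact: L2B (Lsum _ Lf)|exact: L2op|].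
have Ld : L2 (fsub (op s (S f)) f) by exact: L2B.
rewrite (_ : fsub _ _ = fun x => \sum_(n < j) op (neumann_term n) (fsub (op s (S f)) f) x).
  apply/eqP; rewrite eq_le nrm2_ge0 andbT.
  apply: le_trans (nrm2_sum_le _ _) _; first by move=> n; exact: L2op.
  apply: sumr_le0 => n _; apply: le_trans (op_le _ Ld) _.
  by rewrite TS// mulr0.
apply/funext => x; under eq_bigr do rewrite opB.
by rewrite sumrB neumann_telescope /fsub; ring.
Qed.

End Frame.
End Opnorm.

(** * Summing coefficients over a countable set of points *)

Section Assembly.
Variables (R : realType) (d : nat).
Local Notation C := R[i].
Local Notation Fun := (Rd R d -> C).
Local Notation L := (Rdd R d).
Local Notation terms := (seq (C * Rdd R d)).
Implicit Types (f g h : Fun) (nu : L) (z w : C) (s t : terms).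

(** [in_Av_le] asks for an injective sequence even if few points occur. Adjoining the range of [e]
    makes the countable set infinite, hence in bijection with [nat]. *)
Lemma enumerate_countable (T : eqType) (F : nat -> seq T) (e : nat -> T) : injective e ->
  exists2 mu : nat -> T, injective mu & forall n x, x \in F n -> exists k, mu k = x.
Proof.
move=> e_inj; pose D := \bigcup_n ([set` F n] `|` [set e n]).
have cD : countable D.
  apply: bigcup_countable => // n _; apply: finite_set_countable.
  by rewrite finite_setU; split; [exact: finite_seq|exact: finite_set1].
have iD : infinite_set D.
  apply: (@sub_infinite_set _ (range e)).
    by move=> _ [n _ <-]; exists n => //; right.
  rewrite (eq_finite_set (inj_card_eq _)); last by move=> x y _ _; exact: e_inj.
  exact: infinite_nat.
have /card_set_bijP[g [gD gI gS]] : (D #= [set: nat])%card.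
  by apply/card_eqPle; split; [exact: cD|exact/infiniteP].
have /choice[mu muE] : forall n, exists x, D x /\ g x = n.
  by move=> n; have [x Dx gx] := gS n I; exists x.
exists mu => [m n mn|n x xF].
  by rewrite -(muE m).2 -(muE n).2 mn.
have Dx : D x by exists n => //; left.
exists (g x); apply: gI; rewrite ?inE//; first exact: (muE _).1.
exact: (muE _).2.
Qed.

Lemma cabs_Re z : `|complex.Re z| <= cabs z.
Proof.
by rewrite -sqrtr_sqr ler_wsqrtr// lerDl sqr_ge0.
Qed.

Lemma cabs_Im z : `|complex.Im z| <= cabs z.
Proof.
by rewrite -sqrtr_sqr ler_wsqrtr// lerDr sqr_ge0.
Qed.

Lemma cvg_sum_ord (u : nat -> nat -> R) (l : nat -> R) (K : nat) :
  (forall k, u k j @[j --> \oo] --> l k) ->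
  \sum_(k < K) u k j @[j --> \oo] --> \sum_(k < K) l k.
Proof.
move=> ul; elim: K => [|K IH].
  rewrite big_ord0 (_ : (fun j => _) = cst 0); first exact: cvg_cst.
  by apply/funext => j; rewrite big_ord0.
rewrite big_ord_recr (_ : (fun j => _) = fun j => \sum_(k < K) u k j + u K j).
  exact: cvgD.
by apply/funext => j; rewrite big_ord_recr.
Qed.

Lemma cvg_cabs (x y : nat -> R) (p q : R) : x @ \oo --> p -> y @ \oo --> q ->
  cabs (Complex (x j) (y j)) @[j --> \oo] --> cabs (Complex p q).
Proof.
move=> xp yq; rewrite /cabs /=.
apply: (@cvg_comp _ _ _ (fun j => x j ^+ 2 + y j ^+ 2) Num.sqrt); last exact: sqrt_continuous.
by apply: cvgD; rewrite !expr2; under eq_fun do rewrite expr2; exact: cvgM.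
Qed.

Variables (v : L -> R) (e : nat -> L) (a : nat -> terms) (S : Fun -> Fun) (Bd : R).
Hypothesis v_ge1 : forall nu, 1 <= v nu.
Hypothesis e_inj : injective e.
Hypothesis aB : forall K, \sum_(0 <= n < K) wnorm v (a n) <= Bd.
Hypothesis SL : forall f, L2 f -> L2 (S f).
Hypothesis Scvg : forall f, L2 f ->
  nrm2 (fun x => S f x - \sum_(n < j) op (a n) f x) @[j --> \oo] --> (0 : R).

Let v_ge0 nu : 0 <= v nu := le_trans ler01 (v_ge1 nu).

Let r n := wnorm v (a n).

Let r_ge0 n : 0 <= r n. Proof. exact: wnorm_ge0. Qed.

Definition concat_terms i j : terms := flatten [seq a n | n <- index_iota i j].

Lemma coef_concat_terms i j nu : coef (concat_terms i j) nu = \sum_(i <= n < j) coef (a n) nu.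
Proof.
rewrite /concat_terms; elim: index_iota => [|n l IH]; first by rewrite big_nil /coef big_nil.
by rewrite big_cons /= coef_cat IH.
Qed.

Lemma wnorm_concat_terms i j : wnorm v (concat_terms i j) = \sum_(i <= n < j) r n.
Proof.
rewrite /concat_terms; elim: index_iota => [|n l IH]; first by rewrite big_nil /wnorm big_nil.
by rewrite big_cons /= /wnorm big_cat -/(wnorm v _) -/(wnorm v _) IH.
Qed.

Lemma op_concat_terms i j f x : op (concat_terms i j) f x = \sum_(i <= n < j) op (a n) f x.
Proof.
rewrite /concat_terms; elim: index_iota => [|n l IH]; first by rewrite big_nil /op big_nil.
by rewrite big_cons /= op_cat IH.
Qed.

Lemma cvgn_r : cvgn (series r).
Proof.
apply: nondecreasing_is_cvgn.
  by apply: nondecreasing_series => n _ _; exact: r_ge0.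
by exists Bd => _ [K _ <-]; exact: aB.
Qed.

Let total_wnorm := limn (series r).

Lemma series_r_le K : series r K <= total_wnorm.
Proof.
apply: nondecreasing_cvgn_le; last exact: cvgn_r.
by apply: nondecreasing_series => n _ _; exact: r_ge0.
Qed.

Lemma total_wnorm_le : total_wnorm <= Bd.
Proof. by apply: limr_le; [exact: cvgn_r|apply: nearW => K; exact: aB]. Qed.

(** With weights at least 1, summability of the weighted norms gives absolute convergence of the
    coefficients at each point. *)
Lemma cabs_coef_le n nu : cabs (coef (a n) nu) <= r n.
Proof.
have := @sum_coef_le_wnorm _ _ v v_ge0 (a n) [:: nu] isT; rewrite big_seq1.
by apply: le_trans; rewrite ler_peMl ?cabs_ge0.
Qed.

Lemma cvgn_Re nu : cvgn (series (fun n => complex.Re (coef (a n) nu))).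
Proof.
apply: normed_cvg; apply: series_le_cvg cvgn_r => // n /=; first exact: normr_ge0.
by apply: le_trans (cabs_Re _) _; exact: cabs_coef_le.
Qed.

Lemma cvgn_Im nu : cvgn (series (fun n => complex.Im (coef (a n) nu))).
Proof.
apply: normed_cvg; apply: series_le_cvg cvgn_r => // n /=; first exact: normr_ge0.
by apply: le_trans (cabs_Im _) _; exact: cabs_coef_le.
Qed.

Definition total_coef nu : C :=
  Complex (limn (series (fun n => complex.Re (coef (a n) nu))))
          (limn (series (fun n => complex.Im (coef (a n) nu)))).

Lemma cvg_total_coef nu z :
  cabs (coef (concat_terms 0 j) nu - z) @[j --> \oo] --> cabs (total_coef nu - z).
Proof.
have -> : total_coef nu - z = Complex (limn (series (fun n => complex.Re (coef
  (a n) nu))) - complex.Re z)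
   (limn (series (fun n => complex.Im (coef (a n) nu))) - complex.Im z).
  by rewrite /total_coef; case: z.
have -> : (fun j => cabs (coef (concat_terms 0 j) nu - z)) = fun j => cabs (Complex
   (series (fun n => complex.Re (coef (a n) nu)) j - complex.Re z)
   (series (fun n => complex.Im (coef (a n) nu)) j - complex.Im z)).
  apply/funext => j; congr cabs; rewrite coef_concat_terms /series /= -Re_sum.
  have -> : \sum_(0 <= n < j) complex.Im (coef (a n) nu) = complex.Im (\sum_(0
    <= n < j) coef (a n) nu).
    by elim/big_rec2: _ => [//|n y1 y2 _ ->]; case: (coef _ _) y1 => [? ?] [? ?].
  by case: (\sum_(0 <= n < j) coef (a n) nu) z => [? ?] [? ?].
apply: cvg_cabs; apply: cvgB; try exact: cvg_cst; [exact: cvgn_Re|exact: cvgn_Im].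
Qed.

(** For [j >= i] the differences of coefficients are those of the block from [i] to [j], whose
    weighted norm is a piece of the tail. Only finitely many points are involved, so [j] may tend to
    infinity. *)
Lemma tail_le (mu : nat -> L) i K : injective mu ->
  \sum_(k < K) v (mu k) * cabs (total_coef (mu k) - coef (concat_terms 0 i) (mu k))
    <= total_wnorm - series r i.
Proof.
move=> mu_inj.
have H : \sum_(k < K) v (mu k) * cabs (coef (concat_terms 0 j) (mu k) - coef
  (concat_terms 0 i) (mu k)) @[j --> \oo]
    --> \sum_(k < K) v (mu k) * cabs (total_coef (mu k) - coef (concat_terms 0 i) (mu k)).
  apply: (@cvg_sum_ord (fun k j => v (mu k) * cabs (coef (concat_terms 0 j) (mu k) - coef
    (concat_terms 0 i) (mu k)))
    (fun k => v (mu k) * cabs (total_coef (mu k) - coef (concat_terms 0 i) (mu k)))).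
  by move=> k; apply: cvgMr; exact: cvg_total_coef.
apply: (cvgr_to_le H); exists i => // j /= ij.
have E k : coef (concat_terms 0 j) (mu k) - coef (concat_terms 0 i) (mu k) = coef
  (concat_terms i j) (mu k).
  by rewrite !coef_concat_terms (big_cat_nat _ ij)//= addrAC subrr add0r.
under eq_bigr do rewrite E.
apply: (@le_trans _ _ (wnorm v (concat_terms i j))).
  have := @sum_coef_le_wnorm _ _ v v_ge0 (concat_terms i j) (map mu (iota 0 K)).
  rewrite map_inj_uniq// iota_uniq big_map => /(_ isT).
  by rewrite -{1}(subn0 K) -/(index_iota 0 K) big_mkord.
rewrite wnorm_concat_terms lerBrDr; apply: le_trans (series_r_le j).
by rewrite addrC /series /= [leRHS](big_cat_nat _ ij).
Qed.

(** An epsilon/2 argument through the block of the first [i] terms: it approximates [S f] by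
    hypothesis, and the enumerated partial sums approximate it up to the tail. *)
Lemma in_Av_le_series : in_Av_le v S Bd.
Proof.
have [mu mu_inj muE] := enumerate_countable (fun n => map snd (a n)) e_inj.
exists mu, (fun n => total_coef (mu n)); split=> //; split.
  apply: lime_le.
    by apply: is_cvg_nneseries => n _ _; rewrite lee_fin mulr_ge0 ?cabs_ge0.
  apply: nearW => K; rewrite sumEFin lee_fin; apply: le_trans total_wnorm_le.
  (* At [i = 0] nothing is subtracted, and the tail estimate bounds the full weighted sum. *)
  have := tail_le 0 K mu_inj; rewrite /series /= big_geq// subr0 big_mkord.
  by under eq_bigr do rewrite coef_concat_terms big_geq// subr0.
move=> f Lf; have LSf := SL Lf.
have Lcat i : L2 (op (concat_terms 0 i) f) by exact: L2op.
have LP k : L2 (partial_op mu (fun n => total_coef (mu n)) k f).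
  by apply: L2_sum => n; apply: L2Z; exact: L2U.
have H i : exists K, forall k, (K <= k)%N ->
    nrm2 (fsub (op (concat_terms 0 i) f) (partial_op mu (fun n => total_coef (mu n)) k f)) <=
    (total_wnorm - series r i) * nrm2 f.
  (* Beyond this [K] the enumeration has met every point of the first [i] terms, so both operators
     are sums over the same points. *)
  have [K KE] : exists K, forall nu, nu \in map snd (concat_terms 0 i) -> nu \in map mu (iota 0 K).
    have : forall nu, nu \in map snd (concat_terms 0 i) -> exists k, mu k = nu.
      move=> nu /mapP[p /flattenP[t /mapP[n _ ->] pt] ->].
      by apply: (muE n); exact: map_f.
    elim: (map _ _) => [|nu l IH] Hl; first by exists 0%N.
    have [K KE] := IH (fun nu' ninl => Hl nu' (mem_behead (s := nu :: l) ninl)).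
    have [k kE] := Hl nu (mem_head _ _).
    exists (maxn K k.+1) => nu'; rewrite inE => /orP[/eqP ->|/KE/mapP[m mK ->]].
      by rewrite -kE map_f// mem_iota add0n leq_max ltnSn orbT.
    by rewrite map_f//; move: mK; rewrite !mem_iota !add0n /= => mK; rewrite leq_max mK.
  exists K => k Kk.
  have -> : fsub (op (concat_terms 0 i) f) (partial_op mu (fun n => total_coef (mu n)) k f) =
      fun x => \sum_(n <- iota 0 k) (coef (concat_terms 0 i) (mu n) - total_coef (mu n))
        * U (mu n) f x.
    apply/funext => x; rewrite /fsub /partial_op (@op_supp _ _ (concat_terms 0 i) f x
      (map mu (iota 0 k))).
    - rewrite big_map -(big_mkord xpredT (fun n => total_coef (mu n) * U (mu n) f x)).
      rewrite /index_iota subn0 -sumrB; apply: eq_bigr => n _; by rewrite mulrBl.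
    - by rewrite map_inj_uniq// iota_uniq.
    - move=> nu /KE/mapP[m mK ->]; apply: map_f; move: mK; rewrite !mem_iota !add0n /= => mK.
      exact: leq_trans Kk.
  apply: le_trans (nrm2_sum_le _ _) _; first by move=> n; apply: L2Z; exact: L2U.
  apply: (@le_trans _ _ ((\sum_(n < k) v (mu n) * cabs (total_coef (mu n) - coef
    (concat_terms 0 i) (mu n))) * nrm2 f)).
    rewrite -(big_mkord xpredT (fun n => v (mu n) * cabs (total_coef (mu n) - coef
      (concat_terms 0 i) (mu n)))).
    rewrite /index_iota subn0 mulr_suml; apply: ler_sum => n _.
    have LU := L2U (mu n) Lf; rewrite nrm2Z// nrm2U// ler_wpM2r ?nrm2_ge0//.
    rewrite -opprB -mulN1r cabsM cabsN1 mul1r ler_peMl ?cabs_ge0//.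
  by rewrite ler_wpM2r ?nrm2_ge0// tail_le.
apply/cvgr0Pnorm_lt => eps eps0; have eps2 : 0 < eps / 2 by rewrite divr_gt0.
have T0 : (total_wnorm - series r i) * nrm2 f @[i --> \oo] --> (0 : R).
  rewrite -[X in _ --> X](mul0r (nrm2 f)); apply: cvgMl.
  rewrite -[X in _ --> X](subrr total_wnorm); apply: cvgB; [exact: cvg_cst|exact: cvgn_r].
have /cvgr0Pnorm_lt/(_ _ eps2)[i1 _ Hi1] := T0.
have /cvgr0Pnorm_lt/(_ _ eps2)[i2 _ Hi2] := Scvg Lf.
pose i := maxn i1 i2; have [K KH] := H i.
exists K => // k /= /KH Hk; rewrite ger0_norm ?nrm2_ge0//.
have -> : fsub (S f) (partial_op mu (fun n => total_coef (mu n)) k f) = fun x =>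
    fsub (S f) (op (concat_terms 0 i) f) x + fsub (op (concat_terms 0 i) f) (partial_op mu
      (fun n => total_coef (mu n)) k f) x.
  by apply/funext => x; rewrite /fsub addrA subrK.
apply: le_lt_trans (nrm2D _ _) _; [exact: L2B|exact: L2B|].
rewrite [ltRHS]splitr ltrD//.
  have := Hi2 i (leq_maxr _ _); rewrite ger0_norm ?nrm2_ge0//.
  by congr (nrm2 _ < _); apply/funext => x; rewrite /fsub op_concat_terms big_mkord.
apply: le_lt_trans Hk _; apply: le_lt_trans (Hi1 i (leq_maxl _ _)).
exact: ler_norm.
Qed.

End Assembly.

(** * The weighted bound *)

Section Final.
Variables (R : realType) (d n0 : nat).
Local Notation N := n0.+1.
Local Notation C := R[i].
Local Notation Fun := (Rd R d -> C).
Local Notation L := (Rdd R d).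
Local Notation terms := (seq (C * Rdd R d)).
Variables (lam : 'I_N -> L) (c : 'I_N -> C) (S : Fun -> Fun).

Definition finop_terms : terms := [seq (c i, lam i) | i <- index_enum 'I_N].

Lemma finop_op : finop lam c = op finop_terms.
Proof.
by apply/funext => f; apply/funext => x; rewrite /op /finop big_map.
Qed.

Hypothesis HS : is_inverse (op finop_terms) S.
Variables (v : L -> R) (Cw : R) (m : nat).
Hypotheses (Hv : weight v) (Hsub : submultiplicative v) (HC : 0 < Cw).
Hypothesis Hw : forall r : R, 0 <= r -> radial_max_is v r (Cw * (1 + r) ^+ m).

Let R0 := \big[Num.max/0]_(i < N) norm2 (lam i).
Let A := (opnorm S) ^- 2.
Let B := (opnorm (op finop_terms)) ^+ 2.
Let q := (B - A) / (A + B).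
Let rho := Num.max 1 (2 * R0).
Let TAv := \sum_(i < N) v (lam i) * cabs (c i).

Lemma lam_le i : norm2 (lam i) <= R0.
Proof. by rewrite /R0 (bigD1 i)//= le_max lexx. Qed.

Lemma residual_point p : p \in residual finop_terms S -> exists k l, p.2 = add2 (neg2
  (lam l)) (lam k).
Proof.
rewrite inE => /orP[/eqP ->|].
  (* The identity contributes the origin, written as a trivial difference so that each factor of a
     power raises both multiplicity totals by exactly one. *)
  exists ord0, ord0; congr pair; apply: eq_from_tnth => i; rewrite !tnth_mktuple.
    by rewrite addNr.
  by rewrite addNr.
move=> /mapP[p1 /allpairsP[[p2 p3] /= [/mapP[p4 /mapP[l _ ->] ->] /mapP[k _ ->] ->]] ->].
by exists k, l.
Qed.

Lemma residual_pow_point n p : p \in residual_pow finop_terms S n ->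
  balanced lam n p.2 /\ norm2 p.2 <= n%:R * (2 * R0).
Proof.
elim: n p => [|n IH] p.
  rewrite inE => /eqP -> /=; rewrite norm2_zero mul0r; split=> //; exact: balanced0.
move=> /allpairsP[[p1 p2] /= [/residual_point[k [l p1E]] /IH[b2 n2] ->]] /=; rewrite p1E.
split; first exact: balancedS.
apply: le_trans (norm2D _ _) _; rewrite -nat1r mulrDl mul1r; apply: lerD => //.
apply: le_trans (norm2D _ _) _; by rewrite norm2_neg mulr_natl mulr2n; apply: lerD; exact: lam_le.
Qed.

Lemma v_ge0 x : 0 <= v x. Proof. by case: Hv. Qed.

Lemma v_le x : v x <= Cw * (1 + norm2 x) ^+ m.
Proof. by have [] := Hw (norm2_ge0 x) => + _; apply. Qed.

Lemma v_ge1 x : 1 <= v x.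
Proof.
have [_ [v0 [_ vr]]] := Hv; rewrite -v0.
have := vr x 0 1 (lexx _) ler01.
rewrite (_ : scale2 0 x = zero2 R d); last first.
  by congr pair; apply: eq_from_tnth => i; rewrite !tnth_mktuple mul0r.
rewrite (_ : scale2 1 x = x)//; rewrite [RHS]surjective_pairing.
by congr pair; apply: eq_from_tnth => i; rewrite !tnth_mktuple mul1r.
Qed.

Lemma norm2_scale (r : R) (x : L) : norm2 (scale2 r x) = `|r| * norm2 x.
Proof.
rewrite /norm2 /= !tdotZl !tdotZr !mulrA -mulrDr -expr2 sqrtrM ?sqr_ge0//.
by rewrite sqrtr_sqr.
Qed.

(** The radial hypothesis at radius 1 supplies a point of norm 1, whose integer multiples have
    distinct norms. *)
Lemma exists_injection : exists e : nat -> L, injective e.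
Proof.
have [_ [x [x1 _]]] := Hw ler01.
exists (fun n => scale2 n%:R x) => i j /(congr1 (@norm2 R d)).
by rewrite !norm2_scale x1 !mulr1 !normr_nat => /eqP; rewrite eqr_nat => /eqP.
Qed.

Lemma wnorm_residual_pow n : wnorm v (collect (residual_pow finop_terms S n)) <=
  Cw * rho ^+ m * ((1 + n%:R) ^+ m * 'C(n + n0, n0)%:R * q ^+ n).
Proof.
have q0 : 0 <= q by exact: q_ge0 HS.
set s := residual_pow _ _ n; pose V := Cw * rho ^+ m * (1 + n%:R) ^+ m.
have sup_point nu : nu \in supp s -> balanced lam n nu /\ norm2 nu <= n%:R * (2 * R0).
  by rewrite mem_undup => /mapP[p ps ->]; exact: residual_pow_point.
have rho1 : 1 <= rho by rewrite le_max lexx.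
have V0 : 0 <= V.
  by rewrite !mulr_ge0 ?exprn_ge0 ?(ltW HC) ?addr_ge0// (le_trans ler01).
have vV nu : nu \in supp s -> v nu <= V.
  move=> /sup_point[_ nun]; apply: le_trans (v_le nu) _.
  rewrite /V -mulrA -exprMn ler_wpM2l ?(ltW HC)//.
  (* Origin of [rho]: as it dominates both 1 and [2 * R0], [1 + n * (2 * R0)] is at most
     [rho * (1 + n)]. *)
  rewrite lerXn2r ?nnegrE ?mulr_ge0 ?addr_ge0 ?norm2_ge0 ?(le_trans ler01 rho1)//.
  rewrite mulrDr mulr1 lerD// (le_trans nun)// mulrC ler_wpM2r//.
  by rewrite le_max lexx orbT.
rewrite /wnorm /collect big_map /=.
apply: (@le_trans _ _ (V * \sum_(nu <- supp s) cabs (coef s nu))).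
  rewrite mulr_sumr big_seq [leRHS]big_seq; apply: ler_sum => nu nus.
  by rewrite ler_wpM2r ?cabs_ge0// vV.
rewrite [leRHS](_ : _ = V * ('C(n + n0, n0)%:R * q ^+ n)); last by rewrite /V; ring.
rewrite ler_wpM2l//.
have s0 : 0 <= \sum_(nu <- supp s) cabs (coef s nu).
  by apply: sumr_ge0 => nu _; exact: cabs_ge0.
(* Both Cauchy-Schwarz factors, the number of points and the l^2 sum, are bounded by squares, so
   comparing squares leaves a single binomial. *)
rewrite -(@ler_pXn2r _ 2) ?nnegrE ?mulr_ge0 ?exprn_ge0//.
apply: le_trans (sum_sqr_le _ _) _; rewrite exprMn ler_pM//.
- by apply: sumr_ge0 => nu _; rewrite sqr_ge0.
- rewrite -natrX ler_nat; apply: (@balanced_size _ _ _ lam); first exact: undup_uniq.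
  by move=> x /sup_point[].
- exact: residual_pow_coef HS n.
Qed.

Lemma wnorm_scal_adj (r : R) : 0 <= r -> wnorm v (scal r%:C%C (adj finop_terms)) = r * TAv.
Proof.
move=> r0; rewrite /wnorm /scal /adj /finop_terms !big_map /TAv mulr_sumr.
apply: eq_bigr => i _; rewrite /= !cabsM cabs_conj cabs_expi mulr1 cabsr ger0_norm//.
by have [_ [_ [-> _]]] := Hv; rewrite mulrCA.
Qed.

Lemma sum_wnorm_neumann K : \sum_(0 <= n < K) wnorm v (neumann_term finop_terms S n) <=
  Cw * rho ^+ m * TAv / A * ((m + N)`!)%:R * ((A + B) / (2 * A)) ^+ (m + N).
Proof.
have A0 : 0 < A := A_gt0 HS; have AB : A <= B := A_le_B HS.
have B0 := lt_le_trans A0 AB; have AB0 := addr_gt0 A0 B0.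
have TAv0 : 0 <= TAv by apply: sumr_ge0 => i _; rewrite mulr_ge0 ?cabs_ge0 ?v_ge0.
have rho0 : 0 <= rho by rewrite le_max ler01.
have gam0 : 0 <= 2 / (A + B) by rewrite divr_ge0 ?(ltW AB0).
have q0 : 0 <= q by exact: q_ge0 HS.
have q1 : q < 1 by rewrite /q ltr_pdivrMr// mul1r; lra.
rewrite big_mkord.
apply: (@le_trans _ _ (2 / (A + B) * TAv * (Cw * rho ^+ m) *
    \sum_(n < K) (1 + n%:R) ^+ m * 'C(n + n0, n0)%:R * q ^+ n)).
  rewrite mulr_sumr; apply: ler_sum => n _.
  apply: le_trans (wnorm_mult _ _ Hsub) _; rewrite wnorm_scal_adj// mulrC -mulrA.
  by apply: ler_wpM2l; [exact: mulr_ge0|exact: wnorm_residual_pow].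
have -> : (A + B) / (2 * A) = (1 - q)^-1.
  by rewrite (_ : 1 - q = 2 * A / (A + B)) ?invf_div// /q; field; rewrite gt_eqF.
apply: (@le_trans _ _ (2 / (A + B) * TAv * (Cw * rho ^+ m) * ((m + N)`!%:R * (1 - q) ^- (m + N)))).
  rewrite ler_wpM2l ?sum_poly_geometric//.
  by rewrite !mulr_ge0 ?exprn_ge0 ?(ltW HC)// invr_ge0 ltW.
rewrite mulrA exprVn ler_wpM2r ?invr_ge0 ?exprn_ge0 ?subr_ge0 ?(ltW q1)//.
rewrite ler_wpM2r//.
(* The relaxation parameter [2 / (A + B)] is at most [1 / A] because [A <= B]; this gives the
   denominator of the bound. *)
rewrite [leLHS](_ : _ = TAv * (2 / (A + B) * (Cw * rho ^+ m))); last by ring.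
rewrite [leRHS](_ : _ = TAv * (A^-1 * (Cw * rho ^+ m))); last by ring.
rewrite ler_wpM2l// ler_wpM2r ?mulr_ge0 ?exprn_ge0 ?(ltW HC)//.
rewrite ler_pdivrMr// mulrC ler_pdivlMr//; lra.
Qed.

Lemma inverse_in_Av : in_Av_le v S
  (Cw * rho ^+ m * TAv / A * ((m + N)`!)%:R * ((A + B) / (2 * A)) ^+ (m + N)).
Proof.
have [e e_inj] := exists_injection; have [[SL _] _] := HS.
apply: (in_Av_le_series v_ge1 e_inj sum_wnorm_neumann SL) => f Lf.
have A0 : 0 < A := A_gt0 HS; have AB : A <= B := A_le_B HS.
have B0 := lt_le_trans A0 AB; have AB0 := addr_gt0 A0 B0.
have q0 : 0 <= q by exact: q_ge0 HS.
have q1 : q < 1 by rewrite /q ltr_pdivrMr// mul1r; lra.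
have qn : q ^+ j * nrm2 (S f) @[j --> \oo] --> (0 : R).
  rewrite -[X in _ --> X](mul0r (nrm2 (S f))); apply: cvgMl.
  by apply: cvg_expr; rewrite ger0_norm.
apply: squeeze_cvgr qn; last exact: cvg_cst.
by apply: nearW => j; rewrite nrm2_ge0 (partial_inverse HS).
Qed.

End Final.

Theorem theorem3 (R : realType) (d N : nat)
  (lam : 'I_N -> Rdd R d) (c : 'I_N -> R[i]) (lam_inj : injective lam)
  (S : (Rd R d -> R[i]) -> (Rd R d -> R[i]))
  (HS : is_inverse (finop lam c) S)
  (v : Rdd R d -> R) (Cw : R) (m : nat)
  (Hv : weight v) (Hsub : submultiplicative v) (HC : 0 < Cw)
  (Hw : forall r : R, 0 <= r -> radial_max_is v r (Cw * (1 + r) ^+ m)) :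
  let R0 := \big[Num.max/0]_(i < N) norm2 (lam i) in
  let A := (opnorm S) ^- 2 in
  let B := (opnorm (finop lam c)) ^+ 2 in
  let rho := Num.max 1 (2 * R0) in
  let TAv := \sum_(i < N) v (lam i) * cabs (c i) in
  in_Av_le v S
    (Cw * rho ^+ m * TAv / A * ((m + N)`!)%:R * ((A + B) / (2 * A)) ^+ (m + N)).
Proof.
case: N lam c lam_inj HS => [|n0] lam c _ HS.
  (* For [N = 0] the operator is zero and cannot be invertible, since L^2 contains a unit vector. *)
  have S0 : is_inverse (op ([::] : seq (R[i] * Rdd R d))) S.
    rewrite (_ : op [::] = finop lam c)//; apply/funext => f; apply/funext => x.
    by rewrite /op big_nil /finop big_ord0.
  by have := inverse_nonnil S0; rewrite eqxx.
rewrite (finop_op lam c) in HS *.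
exact: (inverse_in_Av HS Hv Hsub HC Hw).
Qed.
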